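(* Let $(\mathfrak g,[\cdot,\cdot]_{\mathfrak g},r)$ be a triangular Lie bialgebra, with $\mathfrak g$ finite-dimensional. Then $\big(\bigoplus_n\mathrm{Im}^n(\mathfrak i),\mathcal D\big)$ is a subcomplex of the cochain complex $\big(\bigoplus_n\mathfrak C^n(\mathfrak g,\mathrm{ad}^*,r^\sharp),\mathcal D\big)$ associated to the relative Rota-Baxter Lie algebra $((\mathfrak g,[\cdot,\cdot]_{\mathfrak g}),\mathrm{ad}^*,r^\sharp)$, where $\mathrm{Im}^n(\mathfrak i)=\mathfrak i(\mathfrak C^n_{\mathrm{TLB}}(\mathfrak g,r))$ is the image of the embedding $\mathfrak i$ defined in the context.
   Context: $\mathbf K$ is a field of characteristic $0$; all vector spaces are finite-dimensional; $\mathbb S_{(i,j)}$ denotes $(i,j)$-shuffles. The pairing between $\wedge^k\mathfrak g$ and $\wedge^k\mathfrak g^*$ is $\langle x_1\wedge\cdots\wedge x_k,\xi_1\wedge\cdots\wedge\xi_k\rangle=\det(\langle x_i,\xi_j\rangle)$. Triangular Lie bialgebra: for a Lie algebra $\mathfrak g$ the Schouten-Nijenhuis bracket is $[x_1\wedge\cdots\wedge x_p,y_1\wedge\cdots\wedge y_q]_{SN}=\sum_{i,j}(-1)^{i+j}[x_i,y_j]_{\mathfrak g}\wedge x_1\wedge\cdots\hat x_i\cdots\wedge x_p\wedge y_1\wedge\cdots\hat y_j\cdots\wedge y_q$. A skew-symmetric $r$-matrix is $r\in\wedge^2\mathfrak g$ with $[r,r]_{SN}=0$; then $\mathfrak g$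 with cobracket $\delta_r(x)=[x,r]_{SN}$ is a Lie bialgebra, called triangular and denoted $(\mathfrak g,[\cdot,\cdot]_{\mathfrak g},r)$. The map $r^\sharp:\mathfrak g^*\to\mathfrak g$, $\langle r^\sharp(\xi),\eta\rangle=\langle r,\xi\wedge\eta\rangle$, is then a relative Rota-Baxter operator with respect to the coadjoint representation $\mathrm{ad}^*$ of $\mathfrak g$ on $\mathfrak g^*$, where a relative Rota-Baxter operator for a representation $\rho:\mathfrak g\to\mathfrak{gl}(V)$ is a linear $T:V\to\mathfrak g$ with $[Tu,Tv]_{\mathfrak g}=T(\rho(Tu)(v)-\rho(Tv)(u))$. The complex $\mathfrak C^*(\mathfrak g,\rho,T)$ of a Lie algebra $(\mathfrak g,\mu)$ with representation $\rho$ on $V$ and relative Rota-Baxter operator $T$ (applied here with $V=\mathfrak g^*$, $\rho=\mathrm{ad}^*$, $T=r^\sharp$): put $\pi=\mu+\rho$. On $\bigoplus_{n\ge0}\mathrm{Hom}(\wedge^{n+1}(\mathfrak g\oplus V),\mathfrak g\oplus V)$ ($n$-th summand in degree $n$) let $[P,Q]_{NR}=P\bar\circ Q-(-1)^{pq}Q\bar\circ P$ with $(P\bar\circ Q)(x_1,\dots,x_{p+q+1})=\sum_{\sigma\in\mathbb S_{(q+1,p)}}(-1)^\sigma P(Q(x_{\sigma(1)},\dots,x_{\sigma(q+1)}),x_{\sigma(q+2)},\dots,x_{\sigma(p+q+1)})$; multilinear maps $f:\wedge^k\mathfrak g\otimes\wedge^lV\to\mathfrak g$ (or $\to V$) are regarded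 as elements of degree $k+l-1$ via $\hat f((x_1,v_1),\dots,(x_{k+l},v_{k+l}))=\sum_{\tau\in\mathbb S_{(k,l)}}(-1)^\tau f(x_{\tau(1)},\dots,x_{\tau(k)},v_{\tau(k+1)},\dots,v_{\tau(k+l)})$ in the summand $\mathfrak g$ (respectively $V$). Then $\mathfrak C^0(\mathfrak g,\rho,T)=0$, $\mathfrak C^1(\mathfrak g,\rho,T)=\mathfrak{gl}(\mathfrak g)\oplus\mathfrak{gl}(V)$, $\mathfrak C^n(\mathfrak g,\rho,T)=\mathrm{Hom}(\wedge^n\mathfrak g,\mathfrak g)\oplus\mathrm{Hom}(\wedge^{n-1}\mathfrak g\otimes V,V)\oplus\mathrm{Hom}(\wedge^{n-1}V,\mathfrak g)$ for $n\ge2$, and $\mathcal D(f,\theta)=(-1)^{n-2}\big(-[\pi,f]_{NR},[[\pi,T]_{NR},\theta]_{NR}+\frac1{n!}\underbrace{[\cdots[[}_nf,T]_{NR},T]_{NR},\cdots,T]_{NR}\big)$ for $f$ in the first two summands and $\theta$ in the third ($\theta=0$ if $n=1$). The embedding: $\mathfrak C^0_{\mathrm{TLB}}(\mathfrak g,r)=0$, $\mathfrak C^1_{\mathrm{TLB}}(\mathfrak g,r)=\mathrm{Hom}(\mathfrak g,\mathfrak g)$, $\mathfrak C^n_{\mathrm{TLB}}(\mathfrak g,r)=\mathrm{Hom}(\wedge^n\mathfrak g,\mathfrak g)\oplus\wedge^n\mathfrak g$ for $n\ge2$. For $k\ge1$, $\Psi:\wedge^{k+1}\mathfrak g\to\mathrm{Hom}(\wedge^k\mathfrak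 g^*,\mathfrak g)$ is given by $\langle\Psi(\chi)(\xi_1,\dots,\xi_k),\xi_{k+1}\rangle=\langle\chi,\xi_1\wedge\cdots\wedge\xi_{k+1}\rangle$. For $f\in\mathrm{Hom}(\wedge^n\mathfrak g,\mathfrak g)$, $f^\star\in\mathrm{Hom}(\wedge^{n-1}\mathfrak g\otimes\mathfrak g^*,\mathfrak g^* )$ is given by $\langle f^\star(x_1,\dots,x_{n-1},\xi),x_n\rangle=-\langle\xi,f(x_1,\dots,x_n)\rangle$. Then $\mathfrak i:\mathfrak C^n_{\mathrm{TLB}}(\mathfrak g,r)\to\mathfrak C^n(\mathfrak g,\mathrm{ad}^*,r^\sharp)$ is $\mathfrak i(f,\chi)=(f,f^\star,\Psi(\chi))$ (and $\mathfrak i(f)=(f,f^\star)$ for $n=1$). *)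

(* Defs.v *)
From HB Require Import structures.
From mathcomp Require Import all_boot all_order all_algebra all_fingroup.
From mathcomp Require Import boolp classical_sets functions.

Set Implicit Arguments.
Unset Strict Implicit.
Unset Printing Implicit Defensive.

Import GRing.Theory.
Local Open Scope ring_scope.
Local Open Scope classical_set_scope.

(* An n-tuple of vectors (x_1,...,x_n) is a finite function on 'I_n, so        *)
(* positions are numbered from 0.  An n-ary map U x ... x U -> W is a plain    *)
(* function {ffun 'I_n -> U} -> W; such functions form an lmodType.            *)

Section Tuples.
Variable T : Type.

Definition upd n (x : {ffun 'I_n -> T}) (i : 'I_n) (u : T) : {ffun 'I_n -> T} :=
  [ffun j => if j == i then u else x j].

Definition fcons n (u : T) (x : {ffun 'I_n -> T}) : {ffun 'I_n.+1 -> T} :=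
  [ffun i => if unlift ord0 i is Some j then x j else u].

Definition frcons n (x : {ffun 'I_n -> T}) (u : T) : {ffun 'I_n.+1 -> T} :=
  [ffun i => if unlift ord_max i is Some j then x j else u].

Definition fcat m n (x : {ffun 'I_m -> T}) (y : {ffun 'I_n -> T}) :
    {ffun 'I_(m + n) -> T} :=
  [ffun i : 'I_(m + n) => match fintype.split i with inl a => x a | inr b => y b end].

Definition fdel n (i : 'I_n.+1) (x : {ffun 'I_n.+1 -> T}) : {ffun 'I_n -> T} :=
  [ffun j => x (lift i j)].

Definition fcast m n (e : m = n) (x : {ffun 'I_n -> T}) : {ffun 'I_m -> T} :=
  [ffun i => x (cast_ord e i)].

End Tuples.

Section Alternating.
Variables (K : fieldType) (U W : vectType K).

Definition multilinear n (f : {ffun 'I_n -> U} -> W) : Prop :=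
  forall x i, linear (fun u => f (upd x i u)).

(* Hom(\wedge^n U, W), viewed as the space of alternating n-linear maps *)
Definition altmap n : set ({ffun 'I_n -> U} -> W) :=
  [set f | multilinear f /\
           (forall (x : {ffun 'I_n -> U}) i j, i != j -> x i = x j -> f x = 0)].

End Alternating.

(* Hom(\wedge^k U \otimes \wedge^l V, W) *)
Definition mixmap (K : fieldType) (U V W : vectType K) k l :
    set ({ffun 'I_k -> U} -> {ffun 'I_l -> V} -> W) :=
  [set f | (forall v, altmap (f^~ v)) /\ (forall x, altmap (f x))].

Section ExteriorPower.
Variables (K : fieldType) (V : vectType K).
Local Notation d := (\dim {:V}).

Definition incmap n :=
  {t : {ffun 'I_n -> 'I_d} |
    [forall i : 'I_n, forall j : 'I_n, (i < j)%N ==> (t i < t j)%N]}.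

(* \wedge^n V in coordinates: the free space on the strictly increasing        *)
(* n-sequences t of basis indices, t standing for                              *)
(* b_(t 0) \wedge ... \wedge b_(t n.-1), where b := vbasis fullv.              *)
(* The universal property is proved below (wedge_altmap, extlift_wedge, ext_span). *)
Definition ext n := {ffun incmap n -> K^o}.
HB.instance Definition _ n := Vector.on (ext n).

Definition wedge n (x : {ffun 'I_n -> V}) : ext n :=
  [ffun t : incmap n => \det (\matrix_(i, j) coord (vbasis {:V}) (sval t j) (x i))].

Definition bvec n (t : 'I_n -> 'I_d) : {ffun 'I_n -> V} :=
  [ffun i => (vbasis {:V})`_(t i)].

(* the linear map \wedge^n V -> W induced by an alternating n-linear f *)
Definition extlift n (W : vectType K) (f : {ffun 'I_n -> V} -> W) (w : ext n) : W :=
  \sum_(t : incmap n) w t *: f (bvec (sval t)).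

End ExteriorPower.

Section AlternatingTheory.
Variables (K : fieldType) (U W : vectType K).

Lemma linear_fsum (h : U -> W) (I : finType) (P : pred I) (F : I -> U) :
  linear h -> h (\sum_(i | P i) F i) = \sum_(i | P i) h (F i).
Proof.
move=> hl; have h0 : h 0 = 0.
  by have := hl (-1) 0 0; rewrite scaler0 addr0 scaleN1r addNr.
apply: (big_morph h _ h0) => u v.
by have := hl 1 u v; rewrite !scale1r.
Qed.

Lemma fcons0 T n u (x : {ffun 'I_n -> T}) : fcons u x ord0 = u.
Proof. by rewrite ffunE unlift_none. Qed.

Lemma fconsS T n u (x : {ffun 'I_n -> T}) i : fcons u x (lift ord0 i) = x i.
Proof. by rewrite ffunE liftK. Qed.

Lemma fcons_del T n (x : {ffun 'I_n.+1 -> T}) : fcons (x ord0) (fdel ord0 x) = x.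
Proof.
apply/ffunP => i; case: (unliftP ord0 i) => [j|] ->; rewrite ?fcons0 // fconsS.
by rewrite ffunE.
Qed.

Lemma upd_fcons0 T n (u v : T) (x : {ffun 'I_n -> T}) :
  upd (fcons u x) ord0 v = fcons v x.
Proof.
apply/ffunP => i; rewrite ffunE; case: (unliftP ord0 i) => [j|] ->.
  by rewrite !fconsS.
by rewrite eqxx fcons0.
Qed.

Lemma upd_fconsS T n (u v : T) (x : {ffun 'I_n -> T}) i :
  upd (fcons u x) (lift ord0 i) v = fcons u (upd x i v).
Proof.
apply/ffunP => k; rewrite ffunE; case: (unliftP ord0 k) => [j|] ->.
  by rewrite !fconsS ffunE (inj_eq lift_inj).
by rewrite !fcons0.
Qed.

Lemma upd_id T n (x : {ffun 'I_n -> T}) i : upd x i (x i) = x.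
Proof. by apply/ffunP => j; rewrite ffunE; case: eqP => // ->. Qed.

Lemma multilinear_fcons n (f : {ffun 'I_n.+1 -> U} -> W) u :
  multilinear f -> multilinear (fun x => f (fcons u x)).
Proof. by move=> fm x i a v w; rewrite -!(upd_fconsS u) fm. Qed.

Lemma linear_scale (h : U -> W) a u : linear h -> h (a *: u) = a *: h u.
Proof.
move=> hl; have h0 : h 0 = 0.
  by have := hl (-1) 0 0; rewrite scaler0 addr0 scaleN1r addNr.
by rewrite -[a *: u]addr0 hl h0 addr0.
Qed.

Lemma multilinear_scale n (f : {ffun 'I_n -> U} -> W) (a : 'I_n -> K)
    (x : {ffun 'I_n -> U}) : multilinear f ->
  f [ffun i => a i *: x i] = (\prod_i a i) *: f x.
Proof.
elim: n f a x => [|n IH] f a x fm.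
  by rewrite big_ord0 scale1r; congr f; apply/ffunP; case.
rewrite big_ord_recl.
set y := [ffun _ => _].
have -> : y = upd (fcons 0 [ffun i => a (lift ord0 i) *: (fdel ord0 x) i]) ord0
                  (a ord0 *: x ord0).
  rewrite upd_fcons0 -[LHS]fcons_del; congr fcons; first by rewrite ffunE.
  by apply/ffunP => i; rewrite !ffunE.
rewrite (linear_scale _ _ (fm _ _)) upd_fcons0.
rewrite (IH (fun x' => f (fcons (x ord0) x'))); last exact: multilinear_fcons.
by rewrite fcons_del scalerA.
Qed.

Lemma multilinear_expand n (J : finType) (f : {ffun 'I_n -> U} -> W)
    (F : 'I_n -> J -> U) : multilinear f ->
  f [ffun i => \sum_j F i j] =
  \sum_(t : {ffun 'I_n -> J}) f [ffun i => F i (t i)].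
Proof.
elim: n f F => [|n IH] f F fm.
  rewrite (bigD1 [ffun i : 'I_0 => match i with Ordinal _ p =>
     False_rect J (notF p) end]) //= big_pred0 ?addr0; last first.
    by move=> t; apply/negbTE/negPn/eqP/ffunP; case.
  by congr f; apply/ffunP; case.
set y := [ffun _ => _].
have -> : y = upd (fcons 0 [ffun i => \sum_j F (lift ord0 i) j]) ord0 (\sum_j F ord0 j).
  rewrite upd_fcons0 -[LHS]fcons_del; congr fcons; first by rewrite ffunE.
  by apply/ffunP => i; rewrite !ffunE.
rewrite (linear_fsum _ _ (fm _ _)).
under eq_bigr => j _.
  rewrite upd_fcons0 (IH (fun x' => f (fcons (F ord0 j) x'))); last exact: multilinear_fcons.
  over.
rewrite pair_big /= (reindex (fun t : {ffun 'I_n.+1 -> J} => (t ord0, fdel ord0 t))) /=.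
  apply: eq_bigr => t _; congr f; rewrite -[RHS]fcons_del; congr fcons.
    by rewrite ffunE.
  by apply/ffunP => i; rewrite !ffunE.
exists (fun p => fcons p.1 p.2) => [t _|[j t] _] /=; first exact: fcons_del.
by rewrite fcons0; congr pair; apply/ffunP => i; rewrite ffunE fconsS.
Qed.

Lemma altmap_tperm n (f : {ffun 'I_n -> U} -> W) (x : {ffun 'I_n -> U}) i j : i != j ->
  multilinear f -> (forall y : {ffun 'I_n -> U}, y i = y j -> f y = 0) ->
  f [ffun k => x (tperm i j k)] = - f x.
Proof.
move=> ij fm f0; apply/eqP; rewrite -addr_eq0; apply/eqP.
pose y u v := upd (upd x i u) j v.
have ji : j != i by rewrite eq_sym.
have yz u v : y u v = upd (upd x j v) i u.
  apply/ffunP => k; rewrite !ffunE.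
  by case: (eqVneq k j) (eqVneq k i) => [->|_] [] // e; rewrite -e eqxx in ji.
have y0 u : f (y u u) = 0 by apply: f0; rewrite !ffunE eqxx (negbTE ij) eqxx.
have yDr u v w : f (y u (v + w)) = f (y u v) + f (y u w).
  by rewrite -[v in LHS](scale1r v) fm scale1r.
have yDl u v w : f (y (v + w) u) = f (y v u) + f (y w u).
  by rewrite !yz -[v in LHS](scale1r v) fm scale1r.
have := y0 (x i + x j); rewrite yDl !yDr !y0 add0r addr0 addrC => <-.
have -> : y (x i) (x j) = x by apply/ffunP => k; rewrite !ffunE; do 2!case: eqP => [->|_] //.
congr (f _ + _); apply/ffunP => k; rewrite !ffunE.
case: tpermP => [->|->|ki kj]; rewrite ?eqxx ?(negbTE ij) //.
by move/eqP/negbTE: ki => ->; move/eqP/negbTE: kj => ->.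
Qed.

Lemma altmap_perm n (f : {ffun 'I_n -> U} -> W) (x : {ffun 'I_n -> U}) (s : 'S_n) : altmap f ->
  f [ffun k => x (s k)] = (-1) ^+ odd_perm s *: f x.
Proof.
move=> [fm f0]; case: (prod_tpermP s) => ts -> {s}.
elim: ts => [|t ts IH] /=.
  rewrite big_nil odd_perm1 expr0 scale1r => _; congr f; apply/ffunP => k.
  by rewrite ffunE perm1.
move=> /andP[dt /IH {}IH]; rewrite big_cons odd_permM odd_tperm dt.
set s := (\prod_(t <- ts) _)%g in IH *.
have -> : [ffun k => x ((tperm t.1 t.2 * s)%g k)] =
          [ffun k => [ffun k => x (s k)] (tperm t.1 t.2 k)].
  by apply/ffunP => k; rewrite !ffunE permM.
rewrite altmap_tperm // ?IH; last by move=> y; apply: f0.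
by rewrite signr_addb expr1 mulN1r scaleNr.
Qed.

(* vanishing on equal neighbours is enough *)
Lemma altmap_adj n (f : {ffun 'I_n -> U} -> W) : multilinear f ->
  (forall (x : {ffun 'I_n -> U}) (i j : 'I_n),
     j = i.+1 :> nat -> x i = x j -> f x = 0) ->
  altmap f.
Proof.
move=> fm fa; split=> // x i j ij xij.
wlog lt_ij : i j ij xij / (i < j)%N.
  move=> H; case: (ltngtP i j) => [|lt|/val_inj e]; first exact: H.
    by apply: (H j i); rewrite // eq_sym.
  by rewrite e eqxx in ij.
have [m] := ubnP (j - i)%N; elim: m x i j {ij} xij lt_ij => // m IH x i j xij lt_ij lem.
case: (eqVneq (val j) i.+1) => [e|ne]; first exact: (fa x i j).
have lt_i1j : (i.+1 < j)%N by rewrite ltn_neqAle eq_sym ne.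
have j1n : (j.-1 < n)%N by rewrite (leq_ltn_trans (leq_pred _)).
pose j' := Ordinal j1n.
have jj' : j = j'.+1 :> nat by rewrite /= prednK // (ltn_trans _ lt_i1j).
have j'j : j' != j.
  by apply/eqP => /(congr1 (@nat_of_ord n)); rewrite jj' => /n_Sn.
apply: oppr_inj; rewrite oppr0 -(altmap_tperm x j'j fm); last first.
  by move=> y; apply: fa.
have lt_ij' : (i < j')%N by rewrite -ltnS -jj'.
apply: (IH _ i j') => //; last by rewrite -ltnS (leq_trans _ lem) // ltnS jj' subSn // ltnW.
by rewrite !ffunE tpermL tpermD // -val_eqE /= neq_ltn ?lt_ij ?orbT //; move: lt_ij' => /= ->; rewrite ?orbT.
Qed.

End AlternatingTheory.

Section ExteriorTheory.
Variables (K : fieldType) (V : vectType K).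
Local Notation d := (\dim {:V}).
Local Notation b := (vbasis {:V}).

Let perminc n (p : incmap V n * 'S_n) : {ffun 'I_n -> 'I_d} :=
  [ffun i => sval p.1 (p.2 i)].

Lemma incmapP n (t : incmap V n) (i j : 'I_n) : (i < j)%N -> (sval t i < sval t j)%N.
Proof. by case: t => t /= /forallP/(_ i)/forallP/(_ j)/implyP. Qed.

Lemma incmap_inj n (t : incmap V n) : injective (sval t).
Proof.
move=> i j e; apply/val_inj; case: (ltngtP i j) => // /(incmapP t).
  by rewrite e ltnn.
by rewrite e ltnn.
Qed.

Let codom_perminc n (p : incmap V n * 'S_n) :
  perm_eq (codom (perminc p)) (codom (sval p.1)).
Proof.
apply: uniq_perm.
- apply/injectiveP => i j; rewrite !ffunE => /incmap_inj; exact: perm_inj.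
- by apply/injectiveP; apply: incmap_inj.
move=> y; apply/codomP/codomP => -[i ->]; first by exists (p.2 i); rewrite ffunE.
by exists ((p.2)^-1 i)%g; rewrite ffunE permKV.
Qed.

Let codom_sorted n (t : incmap V n) : sorted ltn (map val (codom (sval t))).
Proof.
rewrite codomE -map_comp sorted_map.
apply: (@sub_sorted _ (fun i j : 'I_n => (i < j)%N)).
  by move=> i j /(incmapP t).
by have := iota_ltn_sorted 0 n; rewrite -val_enum_ord sorted_map.
Qed.

Let perminc_inj n : injective (@perminc n).
Proof.
move=> [t s] [t' s'] e.
have tt' : t = t'.
  apply/val_inj/ffunP => i.
  have pe : perm_eq (map val (codom (sval t))) (map val (codom (sval t'))).
    apply: perm_map; rewrite -(permPl (codom_perminc (t, s))) e.
    exact: codom_perminc.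
  have /(inj_map val_inj) : map val (codom (sval t)) = map val (codom (sval t')).
    by apply: (irr_sorted_eq ltn_trans ltnn) => //; apply: perm_mem.
  by rewrite !codomE => /eq_in_map; apply; rewrite mem_enum.
rewrite -{}tt' in e *; congr pair; apply/permP => i.
by move/ffunP/(_ i): e; rewrite !ffunE => /incmap_inj.
Qed.

Let perminc_surj n (t : {ffun 'I_n -> 'I_d}) :
  injective t -> exists p, t = perminc p.
Proof.
move=> ti.
pose s := sort (fun i j : 'I_d => (i <= j)%N) (codom t).
have ss : size s = n by rewrite size_sort size_codom card_ord.
have tot : total (fun i j : 'I_d => (i <= j)%N) by move=> i j; apply: leq_total.
have us : uniq s by rewrite sort_uniq; apply/injectiveP.
have so : sorted (fun i j : 'I_d => (i < j)%N) s.
  have : sorted ltn (map val s); last by rewrite sorted_map.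
  rewrite ltn_sorted_uniq_leq map_inj_uniq ?us //=; last exact: val_inj.
  by rewrite sorted_map; apply: sort_sorted.
have mt i : t i \in s by rewrite mem_sort codom_f.
pose u : {ffun 'I_n -> 'I_d} := [ffun i => nth (t i) s i].
have uinc : [forall i : 'I_n, forall j : 'I_n, (i < j)%N ==> (u i < u j)%N].
  apply/forallP => i; apply/forallP => j; apply/implyP => ij; rewrite !ffunE.
  rewrite (set_nth_default (t i) (t j)) ?ss //.
  have tr : transitive (fun i j : 'I_d => (i < j)%N) by move=> x y z; apply: ltn_trans.
  by apply: (sorted_ltn_nth tr (t i) so); rewrite ?inE ?ss.
have lt i : (index (t i) s < n)%N by rewrite -[X in (_ < X)%N]ss index_mem.
have si : injective (fun i => Ordinal (lt i)).
  by move=> i j /(congr1 val) /= e; apply: ti; rewrite -(nth_index (t i) (mt i)) e nth_index.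
exists (exist _ u uinc, perm si); apply/ffunP => i.
by rewrite ffunE /= permE ffunE /= nth_index.
Qed.

Lemma altmap_expand (W : vectType K) n (f : {ffun 'I_n -> V} -> W) x : altmap f ->
  f x = \sum_(t : incmap V n)
    \det (\matrix_(i, j) coord b (sval t j) (x i)) *: f (bvec (sval t)).
Proof.
move=> fa; have [fm f0] := fa.
have {1}-> : x = [ffun i => \sum_j coord b j (x i) *: b`_j].
  by apply/ffunP => i; rewrite ffunE -coord_vbasis ?memvf.
rewrite (multilinear_expand (fun i j => coord b j (x i) *: b`_j) fm).
have H (t : {ffun 'I_n -> 'I_d}) : f [ffun i => coord b (t i) (x i) *: b`_(t i)] =
    (\prod_i coord b (t i) (x i)) *: f (bvec t).
  rewrite -multilinear_scale //; congr f; apply/ffunP => i; by rewrite !ffunE.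
under eq_bigr => t _ do rewrite H.
rewrite (bigID (fun t : {ffun 'I_n -> 'I_d} => injectiveb t)) /=.
rewrite [X in _ + X]big1 ?addr0; last first.
  move=> t /injectivePn [i [j ij tij]]; rewrite (f0 _ i j) ?scaler0 //.
  by rewrite !ffunE tij.
transitivity (\sum_(t in [set perminc p | p in [set: incmap V n * 'S_n]]%SET)
    (\prod_i coord b (t i) (x i)) *: f (bvec t)).
  apply: eq_bigl => t; apply/injectiveP/imsetP => [/perminc_surj [p ->]|[p _ ->]].
    by exists p.
  by move=> i j; rewrite !ffunE => /incmap_inj /perm_inj.
rewrite big_imset /=; last by move=> p q _ _; apply: perminc_inj.
rewrite (eq_bigl xpredT) => [|p]; last by rewrite inE.
rewrite -(pair_bigA _ (fun t s => (\prod_i coord b (perminc (t, s) i) (x i)) *: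
  f (bvec (perminc (t, s))))) /=.
apply: eq_bigr => t _; rewrite /determinant scaler_suml; apply: eq_bigr => s _.
have -> : bvec (perminc (t, s)) = [ffun i => bvec (V := V) (sval t) (s i)].
  by apply/ffunP => i; rewrite !ffunE.
rewrite altmap_perm // scalerA mulrC; congr (_ * _ *: _).
by apply: eq_bigr => i _; rewrite mxE ffunE.
Qed.

Lemma extlift_wedge (W : vectType K) n (f : {ffun 'I_n -> V} -> W) x :
  altmap f -> extlift f (wedge x) = f x.
Proof.
move=> fa; rewrite [RHS]altmap_expand //; apply: eq_bigr => t _.
by rewrite ffunE.
Qed.

Lemma extlift_linear (W : vectType K) n (f : {ffun 'I_n -> V} -> W) :
  linear (extlift f).
Proof.
move=> a u v; rewrite /extlift scaler_sumr -big_split; apply: eq_bigr => t _ /=.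
by rewrite !ffunE scalerDl -scalerA.
Qed.

Lemma wedge_altmap n : altmap (@wedge K V n).
Proof.
split=> [x i a u v|x i j ij xij]; apply/ffunP => t; last first.
  rewrite !ffunE; apply: (determinant_alternate ij) => k.
  by rewrite !mxE xij.
have L k : (lift i k == i) = false by rewrite eq_sym; apply/negbTE/neq_lift.
rewrite !ffunE -[X in _ = _ + X]mul1r.
apply: (determinant_multilinear (i0 := i) (b := a) (c := 1)).
- by apply/rowP => k; rewrite !mxE !ffunE eqxx linearP mul1r.
- by apply/matrixP => k l; rewrite !mxE !ffunE L.
- by apply/matrixP => k l; rewrite !mxE !ffunE L.
Qed.

Lemma wedge_bvec n (t u : incmap V n) : wedge (bvec (sval t)) u = (t == u)%:R.
Proof.
rewrite ffunE; case: eqVneq => [<-|].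
  rewrite -(det1 K n); congr determinant; apply/matrixP => i j.
  rewrite !mxE ffunE coord_free ?(basis_free (vbasisP _)) //.
  by rewrite (inj_eq (@incmap_inj _ t)) eq_sym.
move=> ne_tu; apply/eqP/negPn/negP => D; move: ne_tu; apply/negP/negPn/eqP.
have tu i : sval t i \in codom (sval u).
  apply/negPn/negP => nin; move: D; rewrite (expand_det_row _ i) big1 ?eqxx // => j _.
  rewrite mxE ffunE coord_free ?(basis_free (vbasisP _)) //.
  case: eqP => [e|_]; last by rewrite mul0r.
  by rewrite e codom_f in nin.
have si : injective (fun i => iinv (tu i)).
  by move=> i j e; apply: (@incmap_inj _ t); rewrite -(f_iinv (tu i)) -(f_iinv (tu j)) e.
suff : (t, 1%g) = (u, perm si) by case.
apply: perminc_inj; apply/ffunP => i; rewrite !ffunE perm1 permE.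
by rewrite f_iinv.
Qed.

Lemma ext_span n (w : ext V n) :
  w = \sum_(t : incmap V n) w t *: wedge (bvec (sval t)).
Proof.
apply/ffunP => u; rewrite sum_ffunE (bigD1 u) //= big1 ?addr0 => [|t tu].
  by rewrite [RHS]ffunE wedge_bvec eqxx [RHS]mulr1.
by rewrite ffunE wedge_bvec (negbTE tu) [LHS]mulr0.
Qed.

End ExteriorTheory.

Section Pairing.
Variables (K : fieldType) (g : vectType K).

Definition dual := 'Hom(g, K^o).
HB.instance Definition _ := Vector.on dual.

(* linear extension of                                                         *)
(* <x_1 \wedge ... \wedge x_n, xi_1 \wedge ... \wedge xi_n> = det (<x_i, xi_j>);*)
(* see pairing_wedge                                                           *)
Definition pairing n (w : ext g n) (z : ext dual n) : K :=
  extlift (fun x : {ffun 'I_n -> g} =>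
    extlift (fun xi : {ffun 'I_n -> dual} =>
      \det (\matrix_(i, j) (xi j : 'Hom(g, K^o)) (x i)) : K^o) z) w.

(* the vector of g representing a linear form phi on g^*; see predualE *)
Definition predual (phi : dual -> K) : g :=
  \sum_i phi (linfun (coord (vbasis {:g}) i : g -> K^o)) *: (vbasis {:g})`_i.

(* <Psi chi (xi_1,...,xi_k), eta> = <chi, xi_1 \wedge ... \wedge xi_k \wedge eta> *)
Definition Psi k (chi : ext g k.+1) (xi : {ffun 'I_k -> dual}) : g :=
  predual (fun eta => pairing chi (wedge (frcons xi eta))).

(* <rsharp r xi, eta> = <r, xi \wedge eta> *)
Definition rsharp (r : ext g 2) (xi : dual) : g :=
  predual (fun eta => pairing r (wedge (frcons [ffun=> xi] eta))).

(* f^* (x_1,...,x_n.-1, xi) is the form x_n |-> - xi (f (x_1,...,x_n)) *)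
Definition fstar n (f : {ffun 'I_n.+1 -> g} -> g)
    (x : {ffun 'I_n -> g}) (xi : {ffun 'I_1 -> dual}) : dual :=
  linfun (fun y => - (xi ord0 : 'Hom(g, K^o)) (f (frcons x y)) : K^o).

End Pairing.

Section ExtliftAlternating.
Variables (K : fieldType).

Lemma extlift_altmap (U V W : vectType K) m n
    (F : {ffun 'I_m -> U} -> {ffun 'I_n -> V} -> W) (z : ext V n) :
  (forall y, altmap (F^~ y)) -> altmap (fun x => extlift (F x) z).
Proof.
move=> Fa; split=> [x i a u v|x i j ij xij]; last first.
  by rewrite /extlift big1 // => t _; have [_ a] := Fa (bvec (sval t));
    rewrite (a _ i j) ?scaler0.
rewrite /extlift scaler_sumr -big_split; apply: eq_bigr => t _ /=.
by have [m_ _] := Fa (bvec (sval t)); rewrite m_ scalerDr !scalerA mulrC.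
Qed.
End ExtliftAlternating.

Section PairingTheory.
Variables (K : fieldType) (g : vectType K).

Let det_pairing n (x : {ffun 'I_n -> g}) (xi : {ffun 'I_n -> dual g}) : K^o :=
  \det (\matrix_(i, j) (xi j : 'Hom(g, K^o)) (x i)).

Let det_pairing_altl n (xi : {ffun 'I_n -> dual g}) : altmap (fun x => det_pairing x xi).
Proof.
split=> [x i a u v|x i j ij xij]; last first.
  by apply: (determinant_alternate ij) => k; rewrite !mxE xij.
have L k : (lift i k == i) = false by rewrite eq_sym; apply/negbTE/neq_lift.
rewrite -[X in _ = _ + X]mul1r.
apply: (determinant_multilinear (i0 := i) (b := a) (c := 1)).
- by apply/rowP => k; rewrite !mxE !ffunE eqxx linearP mul1r.
- by apply/matrixP => k l; rewrite !mxE !ffunE L.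
- by apply/matrixP => k l; rewrite !mxE !ffunE L.
Qed.

Let det_pairing_altr n (x : {ffun 'I_n -> g}) : altmap (det_pairing x).
Proof.
have -> : det_pairing x =
    fun xi => \det (\matrix_(j, i) (xi j : 'Hom(g, K^o)) (x i)).
  apply/funext => xi; rewrite /det_pairing -det_tr; congr determinant.
  by apply/matrixP => i j; rewrite !mxE.
split=> [xi i a u v|xi i j ij xij]; last first.
  by apply: (determinant_alternate ij) => k; rewrite !mxE xij.
have L k : (lift i k == i) = false by rewrite eq_sym; apply/negbTE/neq_lift.
rewrite -[X in _ = _ + X]mul1r.
apply: (determinant_multilinear (i0 := i) (b := a) (c := 1)).
- by apply/rowP => k; rewrite !mxE !ffunE eqxx add_lfunE scale_lfunE mul1r.
- by apply/matrixP => k l; rewrite !mxE !ffunE L.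
- by apply/matrixP => k l; rewrite !mxE !ffunE L.
Qed.

Lemma pairing_wedge n (x : {ffun 'I_n -> g}) (xi : {ffun 'I_n -> dual g}) :
  pairing (wedge x) (wedge xi) =
  \det (\matrix_(i, j) (xi j : 'Hom(g, K^o)) (x i)).
Proof.
rewrite /pairing (extlift_wedge _ (extlift_altmap _ _)); last exact: det_pairing_altl.
exact: (extlift_wedge xi (det_pairing_altr x)).
Qed.

Lemma pairing_linearr n (w : ext g n) : linear (pairing w : ext (dual g) n -> K^o).
Proof.
move=> a u v; rewrite /pairing /extlift scaler_sumr -big_split.
apply: eq_bigr => t _ /=; have := extlift_linear (det_pairing (bvec (sval t))) a u v.
rewrite /extlift /det_pairing => ->.
by rewrite scalerDr !scalerA [X in X *: _]mulrC.
Qed.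

Lemma predualE (phi : dual g -> K^o) (eta : 'Hom(g, K^o)) :
  linear phi -> eta (predual phi) = phi eta.
Proof.
move=> lphi.
pose e i : dual g := linfun (coord (vbasis {:g}) i : g -> K^o).
have eE : \sum_(i < \dim {:g}) eta (vbasis {:g})`_i *: e i = eta.
  apply/lfunP => v; rewrite {2}(coord_vbasis (memvf v)) linear_sum sum_lfunE.
  apply: eq_bigr => i _; rewrite linearZ scale_lfunE /e.
  by rewrite (lfunE (coord (vbasis {:g}) i : {linear g -> K^o})) [LHS]mulrC.
rewrite -[in RHS]eE (linear_fsum _ _ lphi) linear_sum; apply: eq_bigr => i _.
by rewrite linearZ (linear_scale _ _ lphi) [RHS]mulrC.
Qed.

Lemma Psi_pairing k (chi : ext g k.+1) (xi : {ffun 'I_k -> dual g}) (eta : 'Hom(g, K^o)) :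
  eta (Psi chi xi) = pairing chi (wedge (frcons xi eta)).
Proof.
apply: predualE => a u v.
have [wm _] := wedge_altmap (dual g) k.+1.
have E w : frcons xi w = upd (frcons xi 0) ord_max w.
  apply/ffunP => i; rewrite !ffunE; case: (unliftP ord_max i) => [j|] ->.
    by rewrite eq_sym (negbTE (neq_lift _ _)).
  by rewrite eqxx.
by rewrite (E (_ + _)) (E u) (E v) wm; exact: pairing_linearr.
Qed.

Lemma rsharp_pairing (r : ext g 2) (xi eta : 'Hom(g, K^o)) :
  eta (rsharp r xi) = pairing r (wedge (frcons [ffun=> xi] eta)).
Proof. exact: (@Psi_pairing 1). Qed.

End PairingTheory.

Section Lie.
Variables (K : fieldType) (g : vectType K).

Record lie_bracket (br : g -> g -> g) : Prop := LieBracket {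
  lie_linearl : forall y, linear (br^~ y);
  lie_linearr : forall x, linear (br x);
  lie_alt : forall x, br x x = 0;
  lie_jacobi : forall x y z,
    br x (br y z) + br y (br z x) + br z (br x y) = 0 }.

Variable br : g -> g -> g.

Definition coad (x : g) (xi : dual g) : dual g :=
  linfun (fun y => - (xi : 'Hom(g, K^o)) (br x y) : K^o).

(* Schouten-Nijenhuis bracket, on decomposable elements (sn_dec) and extended  *)
(* bilinearly (sn); see sn_wedge.  The sign (-1)^(i+j) does not change when    *)
(* both indices are shifted by one.                                            *)
Definition sn_dec p q (x : {ffun 'I_p.+1 -> g}) (y : {ffun 'I_q.+1 -> g}) :
    ext g (p + q).+1 :=
  \sum_(i < p.+1) \sum_(j < q.+1) (-1) ^+ (i + j) *:
    wedge (fcons (br (x i) (y j)) (fcat (fdel i x) (fdel j y))).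

Definition sn p q (u : ext g p.+1) (v : ext g q.+1) : ext g (p + q).+1 :=
  extlift (fun x => extlift (fun y => sn_dec x y) v) u.

(* (g, br, r) is a triangular Lie bialgebra *)
Definition triangular (r : ext g 2) : Prop :=
  lie_bracket br /\ sn r r = 0.

End Lie.

Section AlternatingDeletion.
Variables (K : fieldType) (U W : vectType K).

Lemma altmap_sum m n (c : 'I_m -> K) (F : 'I_m -> {ffun 'I_n -> U} -> W) :
  (forall j, altmap (F j)) -> altmap (fun x => \sum_j c j *: F j x).
Proof.
move=> Fa; split=> [x i a u v|x i j ij xij]; last first.
  by rewrite big1 // => k _; have [_ F0] := Fa k; rewrite (F0 _ i j) ?scaler0.
rewrite scaler_sumr -big_split; apply: eq_bigr => k _ /=.
by have [Fm _] := Fa k; rewrite Fm scalerDr !scalerA mulrC.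
Qed.

Lemma altmap_del p (H : U -> {ffun 'I_p -> U} -> W) :
  (forall x, linear (H^~ x)) -> (forall u, altmap (H u)) ->
  altmap (fun x : {ffun 'I_p.+1 -> U} => \sum_(i < p.+1) (-1) ^+ i *: H (x i) (fdel i x)).
Proof.
move=> Hl Ha; apply: altmap_adj => [x k a u v|x a b ab xab].
  rewrite scaler_sumr -big_split; apply: eq_bigr => i _ /=.
  rewrite scalerA [a * _]mulrC -scalerA -scalerDr; congr (_ *: _).
  have L j : (lift i j == i) = false by rewrite eq_sym; apply/negbTE/neq_lift.
  case: (unliftP i k) => [k'|] ->.
    have E w : fdel i (upd x (lift i k') w) = upd (fdel i x) k' w.
      by apply/ffunP => j; rewrite !ffunE (inj_eq lift_inj).
    by have [Hm _] := Ha (x i); rewrite !E !ffunE eq_sym L Hm.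
  have E w : fdel i (upd x i w) = fdel i x.
    by apply/ffunP => j; rewrite !ffunE L.
  by rewrite !E !ffunE eqxx Hl.
have ab' : a != b by apply/eqP => e; move: ab; rewrite e => /n_Sn.
rewrite (bigD1 a) //= (bigD1 b) 1?eq_sym //= big1 ?addr0.
  have -> : fdel a x = fdel b x.
    apply/ffunP => j; rewrite !ffunE.
    case: (eqVneq (j : nat) a) => [ja|ja]; last first.
      congr (x _); apply/val_inj; rewrite /= /bump ab; congr (_ + _)%N.
      by rewrite [in LHS]leq_eqVlt eq_sym (negbTE ja).
    have -> : lift a j = b by apply/val_inj; rewrite /= /bump ja leqnn ab.
    suff -> : lift b j = a by [].
    by apply/val_inj; rewrite /= /bump ja ab ltnn.
  by rewrite xab ab exprS mulN1r scaleNr subrr.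
move=> i /andP[ia ib]; have [_ H0] := Ha (x i).
case: (unliftP i a) ia => [a' ea _|->]; last by rewrite eqxx.
case: (unliftP i b) ib => [b' eb _|->]; last by rewrite eqxx.
rewrite (H0 _ a' b') ?scaler0 //; last by rewrite !ffunE -ea -eb.
by apply: contraNneq ab' => e; rewrite ea eb e.
Qed.
End AlternatingDeletion.

Section SchoutenNijenhuis.
Variables (K : fieldType) (g : vectType K).

Lemma wedge_fcat_altl m n z (b : {ffun 'I_n -> g}) :
  altmap (fun a : {ffun 'I_m -> g} => wedge (fcons z (fcat a b))).
Proof.
have [wm w0] := wedge_altmap g (m + n).+1.
split=> [x i a u v|x i j ij xij].
  have E w : fcat (upd x i w) b = upd (fcat x b) (lshift n i) w.
    apply/ffunP => k; rewrite !ffunE; case: (split_ordP k) => k' ->.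
      by rewrite (inj_eq (@lshift_inj _ _)) ffunE.
    by rewrite eq_rlshift.
  by rewrite !E -!(upd_fconsS z) wm.
apply: (w0 _ (lift ord0 (lshift n i)) (lift ord0 (lshift n j))).
  by rewrite (inj_eq lift_inj) (inj_eq (@lshift_inj _ _)).
rewrite !fconsS !ffunE; case: split_ordP => i' /eqP; last by rewrite eq_lrshift.
rewrite (inj_eq (@lshift_inj _ _)) => /eqP <-.
case: split_ordP => j' /eqP; last by rewrite eq_lrshift.
by rewrite (inj_eq (@lshift_inj _ _)) => /eqP <-.
Qed.

Lemma wedge_fcat_altr m n z (a : {ffun 'I_m -> g}) :
  altmap (fun b : {ffun 'I_n -> g} => wedge (fcons z (fcat a b))).
Proof.
have [wm w0] := wedge_altmap g (m + n).+1.
split=> [x i c u v|x i j ij xij].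
  have E w : fcat a (upd x i w) = upd (fcat a x) (rshift m i) w.
    apply/ffunP => k; rewrite !ffunE; case: (split_ordP k) => k' ->.
      by rewrite eq_lrshift.
    by rewrite (inj_eq (@rshift_inj _ _)) ffunE.
  by rewrite !E -!(upd_fconsS z) wm.
apply: (w0 _ (lift ord0 (rshift m i)) (lift ord0 (rshift m j))).
  by rewrite (inj_eq lift_inj) (inj_eq (@rshift_inj _ _)).
rewrite !fconsS !ffunE; case: split_ordP => i' /eqP; first by rewrite eq_rlshift.
rewrite (inj_eq (@rshift_inj _ _)) => /eqP <-.
case: split_ordP => j' /eqP; first by rewrite eq_rlshift.
by rewrite (inj_eq (@rshift_inj _ _)) => /eqP <-.
Qed.

Variable br : g -> g -> g.

Lemma sn_wedge p q (x : {ffun 'I_p.+1 -> g}) (y : {ffun 'I_q.+1 -> g}) :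
  lie_bracket br -> sn br (wedge x) (wedge y) = sn_dec br x y.
Proof.
move=> brL; have wl n a : linear (fun u => wedge (fcons u a) : ext g n.+1).
  have [wm _] := wedge_altmap g n.+1.
  by move=> c u v; rewrite -(upd_fcons0 0 (c *: u + v) a) -(upd_fcons0 0 u a) -(upd_fcons0 0 v a) wm.
have al y' : altmap (fun x' : {ffun 'I_p.+1 -> g} => @sn_dec _ _ br p q x' y').
  have -> : (fun x' : {ffun 'I_p.+1 -> g} => @sn_dec _ _ br p q x' y') = fun x' =>
      \sum_(i < p.+1) (-1) ^+ i *: \sum_(j < q.+1) (-1) ^+ j *:
        wedge (fcons (br (x' i) (y' j)) (fcat (fdel i x') (fdel j y'))).
    apply/funext => x'; apply: eq_bigr => i _; rewrite scaler_sumr.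
    by apply: eq_bigr => j _; rewrite scalerA exprD.
  pose H u (x' : {ffun 'I_p -> g}) := \sum_(j < q.+1) (-1) ^+ j *:
     wedge (fcons (br u (y' j)) (fcat x' (fdel j y'))).
  apply: (@altmap_del _ _ _ p H) => [x' c u v|u].
    rewrite /H scaler_sumr -big_split; apply: eq_bigr => j _ /=.
    by rewrite (lie_linearl brL) wl scalerDr !scalerA mulrC.
  by apply: altmap_sum => j; apply: wedge_fcat_altl.
have ar x' : altmap (fun y' : {ffun 'I_q.+1 -> g} => @sn_dec _ _ br p q x' y').
  have -> : (fun y' : {ffun 'I_q.+1 -> g} => @sn_dec _ _ br p q x' y') = fun y' =>
      \sum_(j < q.+1) (-1) ^+ j *: \sum_(i < p.+1) (-1) ^+ i *:
        wedge (fcons (br (x' i) (y' j)) (fcat (fdel i x') (fdel j y'))).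
    apply/funext => y'; rewrite /sn_dec exchange_big; apply: eq_bigr => j _.
    by rewrite scaler_sumr; apply: eq_bigr => i _; rewrite scalerA -exprD [(j + i)%N]addnC.
  pose H u (y' : {ffun 'I_q -> g}) := \sum_(i < p.+1) (-1) ^+ i *:
     wedge (fcons (br (x' i) u) (fcat (fdel i x') y')).
  apply: (@altmap_del _ _ _ q H) => [y' c u v|u].
    rewrite /H scaler_sumr -big_split; apply: eq_bigr => i _ /=.
    by rewrite (lie_linearr brL) wl scalerDr !scalerA mulrC.
  by apply: altmap_sum => i; apply: wedge_fcat_altr.
rewrite /sn (extlift_wedge _ (extlift_altmap _ _)) //.
exact: (extlift_wedge y (ar x)).
Qed.

End SchoutenNijenhuis.

(* sigma(1) < ... < sigma(i) and sigma(i+1) < ... < sigma(i+j) *)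
Definition shuffles i j : {set 'S_(i + j)} :=
  [set s : 'S_(i + j) |
    [forall a : 'I_i, forall b : 'I_i,
       (a < b)%N ==> (s (lshift j a) < s (lshift j b))%N] &&
    [forall a : 'I_j, forall b : 'I_j,
       (a < b)%N ==> (s (rshift i a) < s (rshift i b))%N]]%SET.

Section NijenhuisRichardson.
Variables (K : fieldType) (E : vectType K).

Fact circ_cast p q n : (p + q)%N = n -> (q.+1 + p)%N = n.+1.
Proof. by move=> <-; rewrite addSn addnC. Qed.

Fact circ_comm p q n : (p + q)%N = n -> (q + p)%N = n.
Proof. by rewrite addnC. Qed.

(* An element of degree p is a (p+1)-ary map.  The target degree n comes with  *)
(* an explicit proof that n = p + q.                                           *)
Definition circ p q n (e : (p + q)%N = n)
    (P : {ffun 'I_p.+1 -> E} -> E) (Q : {ffun 'I_q.+1 -> E} -> E)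
    (x : {ffun 'I_n.+1 -> E}) : E :=
  let x' := fcast (circ_cast e) x in
  \sum_(s in shuffles q.+1 p)
    (-1) ^+ odd_perm s *:
    P (fcons (Q [ffun i => x' (s (lshift p i))]) [ffun i => x' (s (rshift q.+1 i))]).

Definition nr p q n (e : (p + q)%N = n)
    (P : {ffun 'I_p.+1 -> E} -> E) (Q : {ffun 'I_q.+1 -> E} -> E) :
    {ffun 'I_n.+1 -> E} -> E :=
  circ e P Q - (-1) ^+ (p * q) *: circ (circ_comm e) Q P.

End NijenhuisRichardson.

Section RotaBaxterComplex.
Variables (K : fieldType) (g V : vectType K).
Local Notation E := (g * V)%type.

Definition hat (W : vectType K) k l n (e : (k + l)%N = n)
    (f : {ffun 'I_k -> g} -> {ffun 'I_l -> V} -> W) (z : {ffun 'I_n -> E}) : W :=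
  let z' := fcast e z in
  \sum_(t in shuffles k l)
    (-1) ^+ odd_perm t *:
    f [ffun i => (z' (t (lshift l i))).1] [ffun i => (z' (t (rshift k i))).2].

Definition hatg k l n (e : (k + l)%N = n)
    (f : {ffun 'I_k -> g} -> {ffun 'I_l -> V} -> g) (z : {ffun 'I_n -> E}) : E :=
  (hat e f z, 0).

Definition hatV k l n (e : (k + l)%N = n)
    (f : {ffun 'I_k -> g} -> {ffun 'I_l -> V} -> V) (z : {ffun 'I_n -> E}) : E :=
  (0, hat e f z).

(* the image in the Nijenhuis-Richardson algebra of                            *)
(* Hom(\wedge^n g, g), Hom(\wedge^(n-1) g \otimes V, V), Hom(\wedge^(n-1) V, g) *)
Definition emb_g n (f : {ffun 'I_n -> g} -> g) : {ffun 'I_n -> E} -> E :=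
  hatg (addn0 n) (fun x _ => f x).
Definition emb_gV n (f : {ffun 'I_n -> g} -> {ffun 'I_1 -> V} -> V) :
    {ffun 'I_n.+1 -> E} -> E :=
  hatV (addn1 n) f.
Definition emb_V n (f : {ffun 'I_n -> V} -> g) : {ffun 'I_n -> E} -> E :=
  hatg (add0n n) (fun _ v => f v).

(* C^n is realised inside pairs of Nijenhuis-Richardson elements (P, Q), with  *)
(* P = emb_g f + emb_gV h of degree n-1 and Q = emb_V theta of degree n-2.     *)
Definition amb n : lmodType K :=
  (({ffun 'I_n -> E} -> E) * ({ffun 'I_n.-1 -> E} -> E))%type.

Definition rrb_cochain n : set (amb n) :=
  match n return set (amb n) with
  | 0 => [set 0]
  | 1 => [set c | exists f h, [/\ @altmap K g g 1 f, @mixmap K g V V 0 1 h &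
            c = (emb_g f + emb_gV h, 0)]]
  | m.+2 => [set c | exists f h t,
            [/\ @altmap K g g m.+2 f, @mixmap K g V V m.+1 1 h,
                @altmap K V g m.+1 t &
                c = (emb_g f + emb_gV h, emb_V t)]]
  end.

Variables (br : g -> g -> g) (rho : g -> V -> V) (T : V -> g).

Definition pi_elt : {ffun 'I_2 -> E} -> E :=
  emb_g (fun x : {ffun 'I_2 -> g} => br (x ord0) (x ord_max)) +
  emb_gV (fun (x : {ffun 'I_1 -> g}) (v : {ffun 'I_1 -> V}) =>
            rho (x ord0) (v ord0)).

Definition T_elt : {ffun 'I_1 -> E} -> E :=
  emb_V (fun v : {ffun 'I_1 -> V} => T (v ord0)).

Definition rrb_D n : amb n -> amb n.+1 :=
  match n return amb n -> amb n.+1 with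
  | 0 => fun _ => 0
  | m.+1 => fun c =>
      (* (-1)^(n-2) = (-1)^n with n = m.+1 *)
      (-1) ^+ m.+1 *:
      ((- nr (add1n m) pi_elt c.1,
        match m return ({ffun 'I_m -> E} -> E) -> ({ffun 'I_m.+1 -> E} -> E) with
        | 0 => fun _ => 0
        | l.+1 => fun theta =>
            nr (add1n l) (nr (addn0 1) pi_elt T_elt) theta
        end c.2
        + (m.+1)`!%:R^-1 *:
            iter m.+1 (fun P => nr (addn0 m) P T_elt) c.1) : amb m.+2)
  end.

End RotaBaxterComplex.

Section TriangularComplex.
Variables (K : fieldType) (g : vectType K).

(* C^n_TLB, as a subspace of Hom(\wedge^n g, g) \oplus \wedge^n g *)
Definition tlb_cochain n : set (({ffun 'I_n -> g} -> g) * ext g n) :=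
  match n return set (({ffun 'I_n -> g} -> g) * ext g n) with
  | 0 => [set 0]
  | 1 => [set c | altmap c.1 /\ c.2 = 0]
  | m.+2 => [set c | altmap c.1]
  end.

Definition tlb_emb n : ({ffun 'I_n -> g} -> g) * ext g n -> amb g (dual g) n :=
  match n return ({ffun 'I_n -> g} -> g) * ext g n -> amb g (dual g) n with
  | 0 => fun _ => 0
  | m.+1 => fun c => (emb_g c.1 + emb_gV (fstar c.1), emb_V (Psi c.2))
  end.

Definition tlb_image n : set (amb g (dual g) n) := @tlb_emb n @` @tlb_cochain n.

End TriangularComplex.

(* S is a subcomplex of (C, D): graded subspaces of C stable under D *)
Definition subcomplex (K : fieldType) (A : nat -> lmodType K)
    (C : forall n, set (A n)) (D : forall n, A n -> A n.+1)
    (S : forall n, set (A n)) : Prop :=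
  forall n, [/\ S n `<=` C n,
                submod_closed (mem (S n)) &
                forall c, S n c -> S n.+1 (D n c)].

(* Main.v *)
Require Import Defs.
From HB Require Import structures.
From mathcomp Require Import all_boot all_order all_algebra all_fingroup.
From mathcomp Require Import zify.
From mathcomp Require Import boolp classical_sets functions.

(** Only one property of the maps involved matters: compatibility with the
    symmetric pairing S((x, xi), (y, eta)) = xi y + eta x on E = g (+) g^*.
    Call an n-ary map P : E^n -> E cyclic when the (n+1)-ary form
      flat P (z_1, ..., z_(n+1)) = S (P (z_1, ..., z_n), z_(n+1))
    is alternating in all its arguments.  The image of the embedding consists
    of cyclic maps, and it contains all cyclic maps of the right bidegree:
    - for f alternating, flat (f + f^star) is the alternating sum of the terms
      xi_i (f (x_1, ..., no x_i, ..., x_(n+1))), the shuffle product of f with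
      the evaluation g^* * g -> K (flat_cotangent_lift);
    - flat (Psi chi) is the form xi |-> <chi, xi_1 /\ ... /\ xi_(n+1)>, and
      every alternating form on g^* is of this kind (pairing_surj).

    Bidegrees are recorded by one dilation, (x, xi) |-> (x, 2 xi).  A map of
    bidegree (k inputs from g^*, output in g) or (k+1 inputs from g^*, output in
    g^* ) has a flat that is multiplied by 2^(k+1), and in characteristic 0 the
    powers of 2 are distinct, so this scaling law determines k.  Arity n and
    weight 0 leave room for f and f^star only (cyclic_cotangent_liftP); arity n
    and weight n leave room for maps (g^* )^n -> g only (cyclic_PsiP).

    The heart of the proof is that cyclic maps are closed under the
    Nijenhuis-Richardson bracket.  Cyclicity of P moves it across the pairing:
      S (P (Q u, v), c) = +- S (Q u, P (v, c)),
    so S (P o Q, z_last) sums +- S (Q u, P v) over the shuffles that send z_last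
    to v, and S (Q o P, z_last) sums the same terms over the shuffles that send
    z_last to u.  The bracket therefore puts together the sum over all
    shuffles (flat_nr), and the shuffle product of two alternating expressions is
    alternating (shuffle_sum_altmap).  Weights add up under the bracket.

    Now mu + ad^* = mu + mu^star is cyclic of weight 0 and r^sharp = Psi r is
    cyclic of weight 1.  In degree n, the first component -[pi, f + f^star] of
    the differential is thus cyclic of weight 0, and both terms of the second
    one are cyclic of weight n and arity n, hence in the image.  *)

Set Implicit Arguments.
Unset Strict Implicit.
Unset Printing Implicit Defensive.

Import GRing.Theory.
Local Open Scope ring_scope.

(** * Shuffle sums *)

Section ShuffleSums.
Variables (K : fieldType) (U W : vectType K).

(** The antisymmetrised product underlying both the maps hat f and the
    composition circ: allowing any G covers both, and gives them a common
    calculus. *)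
Definition shuffle_sum i j n (e : (i + j)%N = n)
    (G : {ffun 'I_i -> U} -> {ffun 'I_j -> U} -> W) (x : {ffun 'I_n -> U}) : W :=
  \sum_(s in shuffles i j) (-1) ^+ odd_perm s *:
    G [ffun a => fcast e x (s (lshift j a))] [ffun b => fcast e x (s (rshift i b))].

Definition ordL i j n (e : (i + j)%N = n) (a : 'I_i) : 'I_n := cast_ord e (lshift j a).
Definition ordR i j n (e : (i + j)%N = n) (b : 'I_j) : 'I_n := cast_ord e (rshift i b).

(** The shuffles as permutations of 'I_n, with n not written as a sum:
    induction on n then needs no transport along equalities of naturals. *)
Definition block_incr n i : {set 'S_n} :=
  [set s : 'S_n | [forall a : 'I_n, forall b : 'I_n,
     (a < b)%N && ((b < i)%N || (i <= a)%N) ==> (s a < s b)%N]]%SET.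

Lemma block_incrP n i (s : 'S_n) :
  reflect (forall a b : 'I_n, (a < b)%N -> (b < i)%N || (i <= a)%N -> (s a < s b)%N)
          (s \in block_incr n i).
Proof.
rewrite inE; apply: (iffP forallP) => [H a b ab ib|H a].
  by move/forallP/(_ b): (H a); rewrite ab ib.
by apply/forallP => b; apply/implyP => /andP[]; apply: H.
Qed.

Lemma ordLRP i j n (e : (i + j)%N = n) (k : 'I_n) :
  (exists a, k = ordL e a) \/ (exists b, k = ordR e b).
Proof.
case: n / e k => k; case: (split_ordP k) => a ->; [left|right]; exists a;
  by apply/val_inj.
Qed.

Lemma ordL_inj i j n (e : (i + j)%N = n) : injective (ordL e).
Proof. by move=> a b /(congr1 val) /= ab; apply/val_inj. Qed.

Lemma ordR_inj i j n (e : (i + j)%N = n) : injective (ordR e).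
Proof. by move=> a b /(congr1 val) /= /addnI ab; apply/val_inj. Qed.

Lemma ordLR i j n (e : (i + j)%N = n) a b : (ordL e a == ordR e b) = false.
Proof.
apply/negbTE/negP => /eqP/(congr1 val) /= E; have := ltn_ord a.
by rewrite E ltnNge leq_addr.
Qed.

Lemma shufflesE i j : shuffles i j = block_incr (i + j) i.
Proof.
apply/setP => s; apply/idP/block_incrP.
  rewrite inE => /andP[/forallP l /forallP r] a b ab.
  case: (split_ordP a) => a' ea; case: (split_ordP b) => b' eb; rewrite {a}ea {b}eb /= in ab *.
  - by move/forallP/(_ b')/implyP: (l a') => ->.
  - by rewrite leqNgt ltn_ord.
  - by move: (ltn_trans ab (ltn_ord b')); rewrite ltnNge leq_addr.
  - by move/forallP/(_ b')/implyP: (r a') => -> //; rewrite -(ltn_add2l i).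
move=> H; rewrite inE; apply/andP; split; apply/forallP => a; apply/forallP => b;
  apply/implyP => ab; apply: H => //=.
- by rewrite ltn_ord.
- by rewrite ltn_add2l.
- by rewrite leq_addr orbT.
Qed.

Lemma shuffle_sumE i j n (e : (i + j)%N = n) G x :
  shuffle_sum e G x = \sum_(s in block_incr n i) (-1) ^+ odd_perm s *:
    G [ffun a => x (s (ordL e a))] [ffun b => x (s (ordR e b))].
Proof.
case: n / e x => x; rewrite /shuffle_sum shufflesE; apply: eq_bigr => s _.
congr (_ *: G _ _); apply/ffunP => a; rewrite !ffunE; congr (x _); apply/val_inj => /=.
  by congr (val (s _)); apply/val_inj.
by congr (val (s _)); apply/val_inj.
Qed.

Lemma incr_perm n (s : 'S_n) :
  (forall a b : 'I_n, (a < b)%N -> (s a < s b)%N) -> s = 1%g.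
Proof.
move=> H; suff E m (a : 'I_n) : (a < m)%N -> s a = a.
  by apply/permP => a; rewrite perm1; apply: (E n).
elim: m a => // m IH a; rewrite ltnS leq_eqVlt => /orP[/eqP am|/IH //].
have {}IH (b : 'I_n) : (b < a)%N -> s b = b by rewrite am; apply: IH.
have [lt|gt|/val_inj //] := ltngtP (s a) a.
  by have /perm_inj E := IH _ lt; move: lt; rewrite E ltnn.
have [lt|gt'|/val_inj E] := ltngtP ((s^-1)%g a) a.
- by have := IH _ lt; rewrite permKV => E; move: lt; rewrite -E ltnn.
- by have := H _ _ gt'; rewrite permKV => /(ltn_trans gt); rewrite ltnn.
- by move: gt; rewrite -{2}E permKV ltnn.
Qed.

Lemma block_incr1 n i : 1%g \in block_incr n i.
Proof. by apply/block_incrP => a b; rewrite !perm1. Qed.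

Lemma shuffle_sum_n0 n (e : (n + 0)%N = n) G x y : shuffle_sum e G x = G x y.
Proof.
rewrite shuffle_sumE (bigD1 1%g) ?block_incr1 //= big_pred0 => [|s].
  rewrite odd_perm1 scale1r addr0; congr G; apply/ffunP => a; last by case: a.
  by rewrite ffunE perm1; congr (x _); apply/val_inj.
apply/andP => -[/block_incrP H]; case/eqP; apply: incr_perm => a b ab.
by apply: H; rewrite ?ltn_ord.
Qed.

Lemma shuffle_sum_0n n (e : (0 + n)%N = n) G x y : shuffle_sum e G x = G y x.
Proof.
rewrite shuffle_sumE (bigD1 1%g) ?block_incr1 //= big_pred0 => [|s].
  rewrite odd_perm1 scale1r addr0; congr G; apply/ffunP => a; first by case: a.
  by rewrite ffunE perm1; congr (x _); apply/val_inj.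
apply/andP => -[/block_incrP H]; case/eqP; apply: incr_perm => a b ab.
by apply: H; rewrite ?orbT.
Qed.

(** If the neighbouring entries a and b of x agree, then the terms where a and
    b fall in the same block vanish, and the others cancel in pairs: exchanging
    a and b turns a shuffle that separates them into another one. *)
Lemma shuffle_sum_altmap i j n (e : (i + j)%N = n) G :
  (forall v, altmap (G^~ v)) -> (forall u, altmap (G u)) -> altmap (shuffle_sum e G).
Proof.
move=> Gl Gr; apply: altmap_adj => [x k a u v|x a b ab xab].
  rewrite !shuffle_sumE scaler_sumr -big_split; apply: eq_bigr => s _ /=.
  rewrite scalerA [a * _]mulrC -scalerA -scalerDr; congr (_ *: _).
  have [[k' ek]|[k' ek]] := ordLRP e ((s^-1)%g k).
    have {ek} -> : k = s (ordL e k') by rewrite -ek permKV.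
    have EL w : [ffun c => upd x (s (ordL e k')) w (s (ordL e c))] =
              upd [ffun c => x (s (ordL e c))] k' w.
      by apply/ffunP => c; rewrite !ffunE (inj_eq perm_inj) (inj_eq (@ordL_inj _ _ _ _)).
    have ER w : [ffun c => upd x (s (ordL e k')) w (s (ordR e c))] =
              [ffun c => x (s (ordR e c))].
      by apply/ffunP => c; rewrite !ffunE (inj_eq perm_inj) eq_sym ordLR.
    by rewrite !EL !ER; have [m _] := Gl [ffun c => x (s (ordR e c))]; rewrite m.
  have {ek} -> : k = s (ordR e k') by rewrite -ek permKV.
  have EL w : [ffun c => upd x (s (ordR e k')) w (s (ordR e c))] =
            upd [ffun c => x (s (ordR e c))] k' w.
    by apply/ffunP => c; rewrite !ffunE (inj_eq perm_inj) (inj_eq (@ordR_inj _ _ _ _)).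
  have ER w : [ffun c => upd x (s (ordR e k')) w (s (ordL e c))] =
            [ffun c => x (s (ordL e c))].
    by apply/ffunP => c; rewrite !ffunE (inj_eq perm_inj) ordLR.
  by rewrite !EL !ER; have [m _] := Gr [ffun c => x (s (ordL e c))]; rewrite m.
have ne_ab : a != b by apply/eqP => E; move: ab; rewrite E => /n_Sn.
have lt_ab : (a < b)%N by rewrite ab.
(* lft s c: the shuffle s takes the entry c of x into the left block. *)
pose lft (s : 'S_n) c := ((s^-1)%g c < i)%N.
rewrite shuffle_sumE.
rewrite (bigID (fun s => lft s a)) /= (bigID (fun s => lft s b)) /=.
rewrite [X in _ + X](bigID (fun s => lft s b)) /=.
rewrite big1 => [|s /andP[/andP[_ la] lb]]; last first.
  rewrite /lft in la lb.
  have [[a' ea]|[a' ea]] := ordLRP e ((s^-1)%g a); last first.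
    by move: la; rewrite ea /= ltnNge leq_addr.
  have [[b' eb]|[b' eb]] := ordLRP e ((s^-1)%g b); last first.
    by move: lb; rewrite eb /= ltnNge leq_addr.
  have [_ H] := Gl [ffun c => x (s (ordR e c))]; rewrite (H _ a' b') ?scaler0 //.
    by apply: contra ne_ab => /eqP E; rewrite -[a](permKV s) -[b](permKV s) ea eb E.
  by rewrite !ffunE -ea -eb !permKV.
(* What precedes is the case of both entries on the left; now on the right. *)
rewrite add0r addrCA [X in _ + (_ + X)]big1 => [|s /andP[/andP[_ la] lb]]; last first.
  rewrite /lft in la lb.
  have [[a' ea]|[a' ea]] := ordLRP e ((s^-1)%g a).
    by move: la; rewrite ea /= ltn_ord.
  have [[b' eb]|[b' eb]] := ordLRP e ((s^-1)%g b).
    by move: lb; rewrite eb /= ltn_ord.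
  have [_ H] := Gr [ffun c => x (s (ordL e c))]; rewrite (H _ a' b') ?scaler0 //.
    by apply: contra ne_ab => /eqP E; rewrite -[a](permKV s) -[b](permKV s) ea eb E.
  by rewrite !ffunE -ea -eb !permKV.
rewrite addr0; apply/eqP; rewrite addr_eq0; apply/eqP.
pose t := tperm a b.
have tt : (t * t = 1)%g by apply: tperm2.
have lt_t s c : lft (s * t)%g c = lft s (t c).
  by rewrite /lft invMg tpermV permM.
(* Nothing lies strictly between a and b, so no comparison is affected. *)
have sht s : lft s a != lft s b -> s \in block_incr n i -> (s * t)%g \in block_incr n i.
  move=> lab /block_incrP H; apply/block_incrP => c d cd cdi; have := H c d cd cdi.
  rewrite !permM /t.
  have same : lft s (s c) = lft s (s d).
    rewrite /lft !permK; case/orP: cdi => h; first by rewrite h (ltn_trans cd).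
    by rewrite !ltnNge h (leq_trans h (ltnW cd)).
  case: tpermP => [sc|sc|/eqP ca /eqP cb]; case: tpermP => [sd|sd|/eqP da /eqP db].
  - by rewrite sc sd ltnn.
  - by move: lab; rewrite -sc -sd same eqxx.
  - by rewrite sc ab => h; rewrite ltn_neqAle eq_sym -ab val_eqE db ab.
  - by move: lab; rewrite -sc -sd same eqxx.
  - by rewrite sc sd ltnn.
  - by rewrite sc => h; apply: ltn_trans h.
  - by rewrite sd => h; apply: ltn_trans lt_ab.
  - by rewrite sd ab ltnS leq_eqVlt val_eqE (negbTE ca).
  - by [].
rewrite (reindex_onto (fun s => s * t)%g (fun s => s * t)%g) /=; last first.
  by move=> s _; rewrite -mulgA tt mulg1.
rewrite -sumrN; apply: eq_big => [s|s].
  rewrite !lt_t tpermL tpermR -mulgA tt mulg1 eqxx andbT.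
  case la: (lft s a); case lb: (lft s b); rewrite ?andbF ?andbT //=.
  apply/idP/idP; last by apply: sht; rewrite la lb.
  move=> h; rewrite -[s]mulg1 -tt mulgA; apply: sht h.
  by rewrite !lt_t tpermL tpermR la lb.
move=> _; rewrite odd_permM odd_tperm ne_ab addbT.
have xt c : x (t c) = x c by rewrite /t; case: tpermP => [->|->|] //.
have -> : (-1) ^+ (~~ odd_perm s) = - (-1) ^+ odd_perm s :> K.
  by case: odd_perm; rewrite ?expr1 ?expr0 ?opprK.
rewrite scaleNr; congr (- (_ *: G _ _)); apply/ffunP => c; by rewrite !ffunE permM xt.
Qed.

End ShuffleSums.

Section ShuffleSplit.
Variables (K : fieldType) (U W : vectType K).

Lemma big_lift_perm n (k m : 'I_n.+1) (P : pred 'S_n.+1) (F : 'S_n.+1 -> W) :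
  \sum_(s | P s && (s k == m)) F s =
  \sum_(s | P (lift_perm k m s)) F (lift_perm k m s).
Proof.
rewrite (reindex (lift_perm k m)) /=.
  by apply: eq_bigl => s; rewrite lift_perm_id eqxx andbT.
pose f (s : 'S_n.+1) j := odflt j (unlift (s k) (s (lift k j))).
have fK (s : 'S_n.+1) j : lift (s k) (f s j) = s (lift k j).
  rewrite /f; case: unliftP => [j' -> //|/perm_inj/eqP].
  by rewrite eq_sym (negbTE (neq_lift _ _)).
have f_inj s : injective (f s).
  by move=> a b /(congr1 (lift (s k))); rewrite !fK => /perm_inj/lift_inj.
exists (fun s => perm (f_inj s)) => s.
  by move=> _; apply/permP => j; rewrite permE /f lift_perm_lift lift_perm_id liftK.
rewrite unfold_in => /andP[_ /eqP sk]; apply/permP => j.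
case: (unliftP k j) => [j'|] ->; first by rewrite lift_perm_lift permE -sk fK.
by rewrite lift_perm_id.
Qed.

Lemma block_incr_lift_last n i (s : 'S_n) : (i <= n)%N ->
  (lift_perm ord_max ord_max s \in block_incr n.+1 i) = (s \in block_incr n i).
Proof.
move=> lein; have lm (a : 'I_n) : lift ord_max a = a :> nat by rewrite lift_max.
apply/block_incrP/block_incrP => H a b.
  move=> ab abi; have := H (lift ord_max a) (lift ord_max b).
  by rewrite !lift_perm_lift !lm; apply.
case: (unliftP ord_max b) => [b'|] ->; case: (unliftP ord_max a) => [a'|] ->;
  rewrite ?lift_perm_id ?lift_perm_lift ?lm ?ltnn //; first exact: H.
by rewrite ltnNge ltnW.
Qed.

Lemma block_incr_lift_mid n i (s : 'S_n) (k : 'I_n.+1) : val k = i ->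
  (lift_perm k ord_max s \in block_incr n.+1 i.+1) = (s \in block_incr n i).
Proof.
move=> ki; have lm (a : 'I_n) : lift ord_max a = a :> nat by rewrite lift_max.
have lk (a : 'I_n) : lift k a = bump i a :> nat by rewrite -ki.
apply/block_incrP/block_incrP => H a b.
  move=> ab abi; have := H (lift k a) (lift k b).
  rewrite !lift_perm_lift !lm !lk /bump; apply; lia.
case: (unliftP k b) => [b'|] ->; case: (unliftP k a) => [a'|] ->;
  rewrite ?lift_perm_id ?lift_perm_lift ?lm ?lk ?ki ?ltnn //= /bump => ab abi.
- by apply: H; lia.
- lia.
Qed.

(** The last entry of x is placed at the end of one of the two blocks; at the
    end of the left one, it jumps over the j.+1 entries of the right one. *)
Lemma shuffle_sum_last i j n (e : (i.+1 + j.+1)%N = n.+1) (e1 : (i.+1 + j)%N = n)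
    (e2 : (i + j.+1)%N = n) (G : {ffun 'I_i.+1 -> U} -> {ffun 'I_j.+1 -> U} -> W) x :
  shuffle_sum e G x =
    shuffle_sum e1 (fun u v => G u (frcons v (x ord_max))) (fdel ord_max x) +
    (-1) ^+ j.+1 *:
      shuffle_sum e2 (fun u v => G (frcons u (x ord_max)) v) (fdel ord_max x).
Proof.
pose k := ordL e ord_max.
rewrite !shuffle_sumE (bigID (fun s : 'S_n.+1 => s ord_max == ord_max)) /=.
have lein : (i.+1 <= n)%N by rewrite -e1 leq_addr.
congr (_ + _).
  rewrite big_lift_perm; apply: eq_big => [s|s _]; first exact: block_incr_lift_last.
  rewrite odd_lift_perm addbb; congr (_ *: G _ _).
    apply/ffunP => a; rewrite !ffunE -(lift_perm_lift ord_max); congr (x (lift_perm _ _ _ _)).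
    by apply/val_inj; rewrite /= /bump; have := ltn_ord a; lia.
  apply/ffunP => b; rewrite !ffunE; case: (unliftP ord_max b) => [b'|] ->.
    rewrite !ffunE -(lift_perm_lift ord_max); congr (x (lift_perm _ _ _ _)).
    by apply/val_inj; rewrite /= /bump; have := ltn_ord b'; lia.
  congr (x _); rewrite -[RHS](lift_perm_id ord_max ord_max s); congr (lift_perm _ _ _ _).
  by apply/val_inj => /=; lia.
transitivity (\sum_(s | (s \in block_incr n.+1 i.+1) && (s k == ord_max))
   (-1) ^+ odd_perm s *: G [ffun a => x (s (ordL e a))] [ffun b => x (s (ordR e b))]).
  apply: eq_bigl => s; apply: andb_id2l => /block_incrP H.
  
  apply/idP/eqP => [smax|sk]; last first.
    apply/eqP => sm; have /(congr1 val) /= := perm_inj (etrans sk (esym sm)); lia.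
  have [c sc] : exists c, s c = ord_max by exists ((s^-1)%g ord_max); rewrite permKV.
  have top (d : 'I_n.+1) : (c < d)%N -> (d < i.+1)%N || (i.+1 <= c)%N -> False.
    by move=> cd cdi; have := H c d cd cdi; rewrite sc ltnNge -ltnS ltn_ord.
  (* A position after c in its block would carry more than the maximal value. *)
  suff -> : k = c by [].
  apply/val_inj => /=; have [ci|ic|->] // := ltngtP (val c) i.
    by exfalso; apply: (top k ci); rewrite /= ltnSn.
  have cn : (c < n)%N.
    rewrite ltn_neqAle -ltnS ltn_ord andbT; apply: contra smax => /eqP cn.
    by have cm : c = ord_max by [apply/val_inj]; rewrite -{1}cm sc.
  by exfalso; apply: (top ord_max) => //; rewrite ic orbT.
rewrite big_lift_perm scaler_sumr.
apply: eq_big => [s|s _]; first exact: block_incr_lift_mid.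
rewrite scalerA; congr (_ *: G _ _).
- rewrite odd_lift_perm /= !signr_addb !signr_odd -exprD; congr (_ * _).
  by rewrite -[LHS]signr_odd -[RHS]signr_odd; congr (_ ^+ _); lia.
- apply/ffunP => a; rewrite !ffunE; case: (unliftP ord_max a) => [a'|] ->.
    rewrite !ffunE -(lift_perm_lift k); congr (x (lift_perm _ _ _ _)).
    apply/val_inj; rewrite /= /bump; have := ltn_ord a'; lia.
  by rewrite lift_perm_id.
apply/ffunP => b; rewrite !ffunE -(lift_perm_lift k); congr (x (lift_perm _ _ _ _)).
apply/val_inj; rewrite /= /bump; lia.
Qed.

(** Splitting off the last entry on both sides reduces this to smaller blocks,
    without computing the signature of the permutation that swaps them. *)
Lemma shuffle_sum_swap i j n (e : (i + j)%N = n) (e' : (j + i)%N = n)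
   (G : {ffun 'I_i -> U} -> {ffun 'I_j -> U} -> W) x :
  shuffle_sum e G x = (-1) ^+ (i * j) *: shuffle_sum e' (fun v u => G u v) x.
Proof.
have y : {ffun 'I_0 -> U} by apply: finfun; case.
elim: n i j e e' G x => [|n IH] i j e e' G x.
  have [i0 j0] : i = 0%N /\ j = 0%N by lia.
  by subst i j; rewrite scale1r (shuffle_sum_n0 e _ _ y) (shuffle_sum_0n e' _ _ y).
case: i e e' G => [|i] e e' G.
  have jn : j = n.+1 by lia.
  by subst j; rewrite scale1r (shuffle_sum_0n e _ _ y) (shuffle_sum_n0 e' _ _ y).
case: j e e' G => [|j] e e' G.
  have jn : i = n by lia.
  by subst i; rewrite muln0 scale1r (shuffle_sum_n0 e _ _ y) (shuffle_sum_0n e' _ _ y).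
have e1 : (i.+1 + j)%N = n by lia.
have e2 : (i + j.+1)%N = n by lia.
have e1' : (j.+1 + i)%N = n by lia.
have e2' : (j + i.+1)%N = n by lia.
rewrite (shuffle_sum_last e e1 e2) (shuffle_sum_last e' e1' e2').
rewrite (IH _ _ e1 e2') (IH _ _ e2 e1').
rewrite addrC scalerDr !scalerA -!exprD; congr (_ *: _ + _ *: _).
all: by rewrite -[LHS]signr_odd -[RHS]signr_odd; congr (_ ^+ _); lia.
Qed.
End ShuffleSplit.

(** * Alternating maps and appended arguments *)

Section AltMaps.
Variables (K : fieldType) (U W : vectType K).

Lemma altmap_fcons_frcons n (f : {ffun 'I_n.+1 -> U} -> W) a v :
  altmap f -> f (fcons a v) = (-1) ^+ n *: f (frcons v a).
Proof.
move=> fa; pose s : 'S_n.+1 := lift_perm ord0 ord_max 1.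
have -> : fcons a v = [ffun k => frcons v a (s k)].
  apply/ffunP => k; rewrite !ffunE /s.
  case: unliftP => [k'|] ->; rewrite ?lift_perm_lift ?lift_perm_id.
    by rewrite liftK perm1.
  by rewrite unlift_none.
by rewrite altmap_perm // odd_lift_perm odd_perm1 addbF /= signr_odd.
Qed.

Lemma altmap_linear n (f f' : {ffun 'I_n -> U} -> W) a :
  altmap f -> altmap f' -> altmap (fun x => a *: f x + f' x).
Proof.
move=> [fm f0] [fm' f0']; split=> [x i b u v|x i j ij xij].
  rewrite fm fm' !scalerDr !scalerA [a * b]mulrC.
  by rewrite -!addrA; congr (_ + _); rewrite addrCA.
by rewrite (f0 _ i j) ?(f0' _ i j) // scaler0 addr0.
Qed.

Lemma altmap_scale n (f : {ffun 'I_n -> U} -> W) a :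
  altmap f -> altmap (fun x => a *: f x).
Proof.
move=> [fm f0]; split=> [x i b u v|x i j ij xij]; last by rewrite (f0 _ i j) ?scaler0.
by rewrite fm scalerDr !scalerA mulrC.
Qed.

Lemma frcons_max (T : Type) n (x : {ffun 'I_n -> T}) u : frcons x u ord_max = u.
Proof. by rewrite ffunE unlift_none. Qed.

Lemma frcons_lift (T : Type) n (x : {ffun 'I_n -> T}) u i :
  frcons x u (lift ord_max i) = x i.
Proof. by rewrite ffunE liftK. Qed.

Lemma fdel_frcons (T : Type) n (x : {ffun 'I_n -> T}) u : fdel ord_max (frcons x u) = x.
Proof. by apply/ffunP => i; rewrite ffunE frcons_lift. Qed.

Lemma frcons_fcons (T : Type) n (x : {ffun 'I_n -> T}) a b :
  frcons (fcons a x) b = fcons a (frcons x b).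
Proof.
apply/ffunP => i; case: (unliftP ord0 i) => [j|] ->; rewrite ?fcons0 ?fconsS.
  case: (unliftP ord_max j) => [k|] ->.
    have -> : lift ord0 (lift ord_max k) = lift ord_max (lift ord0 k).
      by apply/val_inj; rewrite /= /bump; have := ltn_ord k; lia.
    by rewrite !frcons_lift fconsS.
  have -> : lift ord0 ord_max = ord_max :> 'I_n.+2 by apply/val_inj.
  by rewrite !frcons_max.
have -> : ord0 = lift ord_max ord0 :> 'I_n.+2 by apply/val_inj.
by rewrite frcons_lift fcons0.
Qed.

Lemma upd_frcons (T : Type) n (u v : T) (x : {ffun 'I_n -> T}) i :
  upd (frcons x u) (lift ord_max i) v = frcons (upd x i v) u.
Proof.
apply/ffunP => k; rewrite ffunE; case: (unliftP ord_max k) => [j|] ->.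
  by rewrite !frcons_lift ffunE (inj_eq lift_inj).
by rewrite !frcons_max (negbTE (neq_lift _ _)).
Qed.

Lemma upd_frcons_max (T : Type) n (u v : T) (x : {ffun 'I_n -> T}) :
  upd (frcons x u) ord_max v = frcons x v.
Proof.
apply/ffunP => k; rewrite ffunE; case: (unliftP ord_max k) => [j|] ->.
  by rewrite !frcons_lift eq_sym (negbTE (neq_lift _ _)).
by rewrite !frcons_max eqxx.
Qed.

Lemma altmap_frcons n (f : {ffun 'I_n.+1 -> U} -> W) u :
  altmap f -> altmap (fun x => f (frcons x u)).
Proof.
move=> [fm f0]; split=> [x i a v w|x i j ij xij].
  by rewrite -!upd_frcons fm.
apply: (f0 _ (lift ord_max i) (lift ord_max j)); last by rewrite !frcons_lift.
by rewrite (inj_eq lift_inj).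
Qed.

Lemma altmap_last n (f : {ffun 'I_n.+1 -> U} -> W) x :
  altmap f -> linear (fun u => f (frcons x u)).
Proof. by move=> [fm f0] a u v; 
rewrite -(upd_frcons_max 0 (a *: u + v) x) fm !upd_frcons_max. Qed.

End AltMaps.

Lemma linear_at0 (K : fieldType) (U W : vectType K) (h : U -> W) : linear h -> h 0 = 0.
Proof. by move=> hl; rewrite -[0 in LHS](scale0r 0) (linear_scale _ _ hl) scale0r. Qed.

Lemma altmap_comp (K : fieldType) (U V W X : vectType K) n (h : U -> V) (h' : W -> X)
    (f : {ffun 'I_n -> V} -> W) :
  linear h -> linear h' -> altmap f -> altmap (fun x => h' (f [ffun i => h (x i)])).
Proof.
move=> hl hl' [fm f0]; split=> [x i a u v|x i j ij xij]; last first.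
  by rewrite (f0 _ i j) ?ffunE ?xij // linear_at0.
have E w : [ffun j => h (upd x i w j)] = upd [ffun j => h (x j)] i (h w).
  by apply/ffunP => j; rewrite !ffunE; case: eqP.
by rewrite !E hl fm hl'.
Qed.

(** * Cyclic maps on g (+) g^* and the Nijenhuis-Richardson bracket *)

Section Forms.
Variables (K : fieldType) (g : vectType K).
Hypothesis hK : [pchar K] =i pred0.
Local Notation V := (dual g).
Local Notation E := (g * V)%type.

(** The invariant symmetric pairing on the double of g. *)
Definition spair (a b : E) : K^o := (a.2 : 'Hom(g, K^o)) b.1 + (b.2 : 'Hom(g, K^o)) a.1.

Lemma spairC a b : spair a b = spair b a.
Proof. exact: addrC. Qed.

Lemma spair_linearr a : linear (spair a).
Proof.
move=> c [x xi] [y eta]; rewrite /spair /= add_lfunE scale_lfunE linearP scalerDr.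
by rewrite -!addrA; congr (_ + _); rewrite addrCA.
Qed.

Lemma spair_linearl b : linear (spair^~ b).
Proof. by move=> c u v; rewrite /= !(spairC _ b) spair_linearr. Qed.

Lemma dual_sep (x y : g) : (forall xi : 'Hom(g, K^o), xi x = xi y) -> x = y.
Proof.
move=> H; rewrite (coord_vbasis (memvf x)) (coord_vbasis (memvf y)).
apply: eq_bigr => i _; congr (_ *: _).
have := H (linfun (coord (vbasis {:g}) i : g -> K^o)).
by rewrite !(lfunE (coord (vbasis {:g}) i : {linear g -> K^o})).
Qed.

Lemma spair_sep a b : (forall c, spair a c = spair b c) -> a = b.
Proof.
case: a b => x xi [y eta] H; congr pair.
  by apply: dual_sep => z; have := H (0, z); rewrite /spair /= !linear0 !add0r.
by apply/lfunP => z; have := H (z, 0); rewrite /spair /= !zero_lfunE !addr0.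
Qed.

Definition flat n (P : {ffun 'I_n -> E} -> E) (z : {ffun 'I_n.+1 -> E}) : K^o :=
  spair (P (fdel ord_max z)) (z ord_max).

Definition dilate (a : E) : E := (a.1, 2%:R *: a.2).
Definition dilate_tuple n (z : {ffun 'I_n -> E}) := [ffun i => dilate (z i)].

(** The weight k encodes the bidegree: the exponent k.+1 counts the arguments
    of flat P that are taken in g^*. *)
Definition cyclic n k (P : {ffun 'I_n -> E} -> E) : Prop :=
  altmap (flat P) /\ forall z, flat P (dilate_tuple z) = 2%:R ^+ k.+1 *: flat P z.

Lemma two_neq0 : 2%:R != 0 :> K.
Proof. by rewrite ((pcharf0P K).1 hK). Qed.

Lemma flat_frcons n (P : {ffun 'I_n -> E} -> E) z u :
  flat P (frcons z u) = spair (P z) u.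
Proof. by rewrite /flat fdel_frcons frcons_max. Qed.

Lemma flat_inj n (P Q : {ffun 'I_n -> E} -> E) : flat P =1 flat Q -> P = Q.
Proof.
by move=> H; apply/funext => z; apply: spair_sep => u; rewrite -!flat_frcons H.
Qed.

Lemma dilate_tuple_frcons n (z : {ffun 'I_n -> E}) u :
  dilate_tuple (frcons z u) = frcons (dilate_tuple z) (dilate u).
Proof.
apply/ffunP => i; rewrite ffunE; case: (unliftP ord_max i) => [j|] ->.
  by rewrite !frcons_lift ffunE.
by rewrite !frcons_max.
Qed.

Lemma spair_dilate a b : spair (dilate a) (dilate b) = 2%:R *: spair a b.
Proof. by rewrite /spair /= !scale_lfunE -scalerDr. Qed.

(** The scaling law of flat P, read on P itself: the last argument absorbs one
    factor 2 through the pairing. *)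
Lemma cyclic_dilate n k (P : {ffun 'I_n -> E} -> E) z : cyclic k P ->
  P (dilate_tuple z) = 2%:R ^+ k *: dilate (P z).
Proof.
move=> [_ H]; apply: spair_sep => u; have := H (frcons z (u.1, 2%:R^-1 *: u.2)).
have du : dilate (u.1, 2%:R^-1 *: u.2) = u.
  by rewrite /dilate /= scalerA divff ?two_neq0 // scale1r; case: u.
rewrite dilate_tuple_frcons du !flat_frcons => ->.
rewrite (linear_scale _ _ (spair_linearl u)).
by rewrite -[X in spair (dilate _) X]du spair_dilate scalerA -exprSr.
Qed.

Lemma cyclic_linear n k a (P Q : {ffun 'I_n -> E} -> E) : cyclic k P -> cyclic k Q ->
  cyclic k (a *: P + Q).
Proof.
move=> [Pa Pw] [Qa Qw].
have F z : flat (a *: P + Q) z = a *: flat P z + flat Q z by exact: spair_linearl.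
split; first by rewrite (funext F); apply: altmap_linear.
move=> z; rewrite !F Pw Qw; move: (flat P z) (flat Q z) => p q.
by rewrite scalerDr !scalerA mulrC.
Qed.

Lemma cyclic0 n k : cyclic k (0 : {ffun 'I_n -> E} -> E).
Proof.
have F z : flat (0 : {ffun 'I_n -> E} -> E) z = 0.
  by rewrite /flat /spair /= zero_lfunE linear0 addr0.
split=> [|z]; last by rewrite !F scaler0.
split=> [x i a u v|x i j _ _]; by rewrite !F ?scaler0 ?addr0.
Qed.

Lemma spair_shuffle_sum i j n (e : (i + j)%N = n)
    (G : {ffun 'I_i -> E} -> {ffun 'I_j -> E} -> E) x c :
  spair (shuffle_sum e G x) c = shuffle_sum e (fun u v => spair (G u v) c) x.
Proof.
rewrite (linear_fsum _ _ (spair_linearl c)); apply: eq_bigr => s _.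
by rewrite (linear_scale _ _ (spair_linearl c)).
Qed.

Lemma shuffle_sumZ (U : vectType K) i j n (e : (i + j)%N = n) a
   (G : {ffun 'I_i -> U} -> {ffun 'I_j -> U} -> K^o) x :
  shuffle_sum e (fun u v => a *: G u v) x = a *: shuffle_sum e G x.
Proof. by rewrite scaler_sumr; apply: eq_bigr => s _; rewrite !scalerA mulrC. Qed.

Lemma circ_shuffle_sum p q n (e : (p + q)%N = n) (P : {ffun 'I_p.+1 -> E} -> E)
    (Q : {ffun 'I_q.+1 -> E} -> E) :
  circ e P Q = shuffle_sum (circ_cast e) (fun u v => P (fcons (Q u) v)).
Proof. by []. Qed.

(** Cyclicity of P moves the inner value Q u to the last argument of flat P;
    by symmetry of the pairing, P then acts on the other side. *)
Lemma spair_circ p q n (e : (p + q)%N = n) (P : {ffun 'I_p.+1 -> E} -> E)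
    (Q : {ffun 'I_q.+1 -> E} -> E) x c : altmap (flat P) ->
  spair (circ e P Q x) c =
  (-1) ^+ p.+1 *: shuffle_sum (circ_cast e) (fun u v => spair (Q u) (P (frcons v c))) x.
Proof.
move=> Pa; rewrite circ_shuffle_sum spair_shuffle_sum -shuffle_sumZ; apply: eq_bigr => s _.
congr (_ *: _); rewrite -flat_frcons frcons_fcons altmap_fcons_frcons //.
by rewrite flat_frcons spairC.
Qed.

Fact nr_cast p q n : (p + q)%N = n -> (q.+1 + p.+1)%N = n.+2.
Proof. lia. Qed.

(** The two halves of the bracket are the two parts of the full shuffle sum,
    according to the block that receives the last argument. *)
Lemma flat_nr p q n (e : (p + q)%N = n) (P : {ffun 'I_p.+1 -> E} -> E)
    (Q : {ffun 'I_q.+1 -> E} -> E) z : altmap (flat P) -> altmap (flat Q) ->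
  flat (nr e P Q) z =
  (-1) ^+ p.+1 *: shuffle_sum (nr_cast e) (fun u v => spair (Q u) (P v)) z.
Proof.
move=> Pa Qa.
have e2 : (q + p.+1)%N = n.+1 by lia.
rewrite (shuffle_sum_last (nr_cast e) (circ_cast e) e2).
rewrite (shuffle_sum_swap e2 (circ_cast (circ_comm e))).
have nrE x : nr e P Q x =
    (-1) *: ((-1) ^+ (p * q) *: circ (circ_comm e) Q P x) + circ e P Q x.
  by rewrite scaleN1r addrC.
rewrite /flat nrE spair_linearl (linear_scale _ _ (spair_linearl _)) !spair_circ //.
rewrite addrC scalerDr !scalerA; congr (_ + _ *: _).
  rewrite -exprS -!exprD -[LHS]signr_odd -[RHS]signr_odd; congr (_ ^+ _); lia.
by apply: eq_bigr => s _; rewrite spairC.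
Qed.

Lemma altmap_spair n (P : {ffun 'I_n -> E} -> E) c :
  altmap (flat P) -> altmap (fun x => spair (P x) c).
Proof. by move=> /(altmap_frcons c); under [X in altmap X]funext do rewrite flat_frcons. Qed.

Lemma cyclic_nr p q n (e : (p + q)%N = n) k l (P : {ffun 'I_p.+1 -> E} -> E)
    (Q : {ffun 'I_q.+1 -> E} -> E) : cyclic k P -> cyclic l Q -> cyclic (k + l) (nr e P Q).
Proof.
move=> Pc Qc; have [Pa _] := Pc; have [Qa _] := Qc.
have F := flat_nr e _ Pa Qa; split.
  rewrite (funext F); apply: altmap_scale; apply: shuffle_sum_altmap => u.
    exact: altmap_spair.
  by under [X in altmap X]funext do rewrite spairC; apply: altmap_spair.
move=> z; rewrite !F [RHS]scalerA [X in _ = X *: _]mulrC -[RHS]scalerA; congr (_ *: _).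
rewrite -shuffle_sumZ.
apply: eq_bigr => s _; congr (_ *: _).
have D m (h : 'I_m -> 'I_(q.+1 + p.+1)) :
    [ffun a => fcast (nr_cast e) (dilate_tuple z) (h a)] =
    dilate_tuple [ffun a => fcast (nr_cast e) z (h a)].
  by apply/ffunP => a; rewrite !ffunE.
rewrite !D (cyclic_dilate _ Pc) (cyclic_dilate _ Qc).
rewrite (linear_scale _ _ (spair_linearl _)) (linear_scale _ _ (spair_linearr _)).
by rewrite spair_dilate !scalerA -exprD -exprSr addnC.
Qed.

End Forms.

(** * Cyclic maps of extremal weight *)

Lemma linfunE_linear (K : fieldType) (U W : vectType K) (f : U -> W) :
  linear f -> linfun f =1 f.
Proof.
move=> fl; pose F := GRing.isLinear.Build _ _ _ _ f fl.
pose f' : {linear U -> W} := HB.pack f F.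
exact: (lfunE f').
Qed.

Section CyclicWeights.
Variables (K : fieldType) (g : vectType K).
Hypothesis hK : [pchar K] =i pred0.
Local Notation V := (dual g).
Local Notation E := (g * V)%type.

Lemma pchar0_natr_inj : injective (fun n : nat => n%:R : K).
Proof.
suff H a b : (a <= b)%N -> a%:R = b%:R :> K -> a = b.
  by move=> a b ab; case/orP: (leq_total a b) => /H; [exact|move/(_ (esym ab))].
move=> ab /esym/eqP; rewrite -subr_eq0 -natrB // ((pcharf0P K).1 hK).
by rewrite subn_eq0 => ba; apply/eqP; rewrite eqn_leq ab.
Qed.

(** Expanding each argument along g (+) g^* writes w z as a sum over the sets A
    of positions taken in g^*; the term of A is multiplied by 2^#|A| under
    dilation, so homogeneity kills all terms but those with #|A| = k. *)
Lemma homogeneous_form_eq0 m k (w : {ffun 'I_m -> E} -> K^o) : multilinear w ->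
  (forall z, w (dilate_tuple z) = 2%:R ^+ k *: w z) ->
  (forall z (A : {set 'I_m}), #|A| = k ->
     w [ffun i => if i \in A then (0, (z i).2) else ((z i).1, 0)] = 0) ->
  forall z, w z = 0.
Proof.
move=> wm wd w0 z.
pose F i (b : bool) : E := if b then (0, (z i).2) else ((z i).1, 0).
have -> : z = [ffun i => \sum_b F i b].
  apply/ffunP => i; rewrite ffunE big_bool /F /=; case: (z i) => x xi.
  by congr pair; rewrite /= ?add0r ?addr0.
rewrite (multilinear_expand F wm) big1 // => t _.
pose A := [set i | t i]%SET; pose y := [ffun i => F i (t i)].
have yA : y = [ffun i => if i \in A then (0, (z i).2) else ((z i).1, 0)].
  by apply/ffunP => i; rewrite !ffunE inE.
have [Ak|Ak] := eqVneq #|A| k; first by rewrite -/y yA w0.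
have := wd y.
have -> : dilate_tuple y = [ffun i => (if i \in A then 2%:R else 1) *: y i].
  apply/ffunP => i; rewrite yA !ffunE /dilate; case: (i \in A) => /=.
    by congr pair; rewrite scaler0.
  by rewrite scale1r scaler0.
rewrite (multilinear_scale _ _ wm) -big_mkcond prodr_const -!natrX => /eqP.
rewrite -subr_eq0 -scalerBl scaler_eq0 subr_eq0 => /orP[/eqP/pchar0_natr_inj|/eqP //].
by move/eqP; rewrite eqn_exp2l // (negbTE Ak).
Qed.

Lemma pairing_altmap n (chi : ext g n) :
  altmap (fun xi : {ffun 'I_n -> V} => pairing chi (wedge xi) : K^o).
Proof.
have [wm w0] := wedge_altmap V n.
split=> [x i a u v|x i j ij xij]; first by rewrite wm pairing_linearr.
rewrite (w0 _ _ _ ij xij) -(scale0r (0 : ext V n)).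
by rewrite (linear_scale _ _ (@pairing_linearr _ _ _ chi)) scale0r.
Qed.

Lemma pairing_suml n (I : finType) (c : I -> K) (F : I -> ext g n) z :
  pairing (\sum_i c i *: F i) z = \sum_i c i * pairing (F i) z.
Proof.
have H := @extlift_linear K g K^o n (fun x : {ffun 'I_n -> g} =>
    extlift (fun xi : {ffun 'I_n -> V} =>
      \det (\matrix_(i, j) (xi j : 'Hom(g, K^o)) (x i)) : K^o) z).
rewrite /pairing (linear_fsum _ _ H); apply: eq_bigr => i _.
by rewrite (linear_scale _ _ H).
Qed.

(** Nondegeneracy of the pairing between the exterior powers of g and g^*.
    Summing over all index sequences instead of the increasing ones counts every
    basis element of the exterior power n! times, whence the factor 1/n!. *)
Lemma pairing_surj n (w : {ffun 'I_n -> V} -> K^o) : altmap w ->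
  exists chi : ext g n, forall xi, pairing chi (wedge xi) = w xi.
Proof.
move=> wa; have [wm _] := wa.
pose b := vbasis {:g}.
pose e i : V := linfun (coord b i : g -> K^o).
have eE (xi : 'Hom(g, K^o)) : xi = \sum_(i < \dim {:g}) xi b`_i *: e i.
  apply/lfunP => v; rewrite {1}(coord_vbasis (memvf v)) linear_sum sum_lfunE.
  apply: eq_bigr => i _; rewrite linearZ scale_lfunE /e.
  by rewrite (lfunE (coord b i : {linear g -> K^o})) [LHS]mulrC.
pose I := {ffun 'I_n -> 'I_(\dim {:g})}.
pose et (t : I) := [ffun i => e (t i)].
exists (\sum_(t : I) (n`!%:R^-1 * w (et t)) *: wedge [ffun i => b`_(t i)]) => xi.
rewrite pairing_suml.
transitivity (n`!%:R^-1 * \sum_(t : I) \sum_(s : 'S_n)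
   w (et t) * ((-1) ^+ s * \prod_i (xi i : 'Hom(g, K^o)) b`_(t (s i)))).
  rewrite mulr_sumr; apply: eq_bigr => t _; rewrite -mulrA; congr (_ * _).
  rewrite -mulr_sumr; congr (_ * _); rewrite pairing_wedge -det_tr; apply: eq_bigr => s _.
  by congr (_ * _); apply: eq_bigr => i _; rewrite !mxE !ffunE.
have W : w xi = \sum_(t : I) (\prod_i (xi i : 'Hom(g, K^o)) b`_(t i)) *: w (et t).
  have {1}-> : xi = [ffun i => \sum_(j < \dim {:g}) (xi i : 'Hom(g, K^o)) b`_j *: e j].
    by apply/ffunP => i; rewrite ffunE -eE.
  rewrite (multilinear_expand (fun i (j : 'I_(\dim {:g})) => (xi i : 'Hom(g, K^o)) b`_j *: e j) wm).
  apply: eq_bigr => t _; rewrite -multilinear_scale //; congr w.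
  by apply/ffunP => i; rewrite !ffunE.
rewrite exchange_big /= (eq_bigr (fun=> w xi)) => [|s _].
  rewrite sumr_const card_Sn -[w xi *+ _]mulr_natl mulrA mulVf ?mul1r //.
  by rewrite ((pcharf0P K).1 hK) -lt0n fact_gt0.
(* Reindexing by s turns each inner sum into the expansion W of w xi, the
   two signatures cancelling. *)
pose h (t : I) : I := [ffun i => t ((s^-1)%g i)].
rewrite (reindex h) /=; last first.
  by exists (fun t => [ffun i => t (s i)]) => t _; apply/ffunP => i; rewrite !ffunE ?permK ?permKV.
rewrite W; apply: eq_bigr => t _.
have -> : et (h t) = [ffun i => et t ((s^-1)%g i)] by apply/ffunP => i; rewrite !ffunE.
rewrite altmap_perm // odd_permV -[X in X * _]/((-1) ^+ s * w (et t)).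
rewrite -[RHS]/(_ * w (et t)) mulrACA -signr_addb addbb mul1r mulrC.
by congr (_ * _); apply: eq_bigr => i _; rewrite ffunE permK.
Qed.

Lemma hat_shuffle_sum (V' W : vectType K) k l n (e : (k + l)%N = n) f
    (z : {ffun 'I_n -> (g * V')%type}) :
  hat e f z = shuffle_sum e (fun u v => f [ffun i => (u i).1] [ffun i => (v i).2] : W) z.
Proof.
by apply: eq_bigr => s _; congr (_ *: f _ _); apply/ffunP => i; rewrite !ffunE.
Qed.

Lemma emb_gE n (f : {ffun 'I_n -> g} -> g) (z : {ffun 'I_n -> E}) :
  emb_g f z = (f [ffun i => (z i).1], 0).
Proof.
have y : {ffun 'I_0 -> E} by apply: finfun; case.
by congr pair; rewrite hat_shuffle_sum (shuffle_sum_n0 _ _ _ y).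
Qed.

Lemma emb_VE n (f : {ffun 'I_n -> V} -> g) (z : {ffun 'I_n -> E}) :
  emb_V f z = (f [ffun i => (z i).2], 0).
Proof.
have y : {ffun 'I_0 -> E} by apply: finfun; case.
by congr pair; rewrite hat_shuffle_sum (shuffle_sum_0n _ _ _ y).
Qed.

Lemma flat_Psi n (chi : ext g n.+1) z :
  flat (emb_V (Psi chi)) z = pairing chi (wedge [ffun i => (z i).2]).
Proof.
rewrite /flat emb_VE /spair /= zero_lfunE add0r Psi_pairing.
have -> // : frcons [ffun i => (fdel ord_max z i).2] (z ord_max).2 = [ffun i => (z i).2].
apply/ffunP => i; rewrite [RHS]ffunE; case: (unliftP ord_max i) => [j|] ->.
  by rewrite frcons_lift !ffunE.
by rewrite frcons_max.
Qed.

Lemma snd_linear : linear (snd : E -> V). Proof. by []. Qed.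
Lemma inl_linear : linear (fun x : g => (x, 0) : E).
Proof. by move=> a u v; congr pair; rewrite /= scaler0 addr0. Qed.
Lemma inr_linear : linear (fun x : V => (0, x) : E).
Proof. by move=> a u v; congr pair; rewrite /= scaler0 addr0. Qed.

Lemma cyclic_Psi n (chi : ext g n.+1) : cyclic n (emb_V (Psi chi)).
Proof.
split.
  rewrite (funext (flat_Psi chi)).
  apply: (@altmap_comp _ E V K^o K^o _ snd idfun _ snd_linear _ (pairing_altmap chi)).
  by [].
move=> z; rewrite !flat_Psi; have [pm _] := pairing_altmap chi.
have -> : [ffun i => (dilate_tuple z i).2] = [ffun i => 2%:R *: [ffun i => (z i).2] i].
  by apply/ffunP => i; rewrite !ffunE.
by rewrite (multilinear_scale _ _ pm) prodr_const card_ord.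
Qed.

(** For arity n and weight n, flat Q is determined by its values on (g^* )^n.+1,
    and these are given by some chi. *)
Lemma cyclic_PsiP n (Q : {ffun 'I_n -> E} -> E) : cyclic n Q ->
  exists chi : ext g n.+1, Q = emb_V (Psi chi).
Proof.
move=> Qc; have [Qa _] := Qc.
have [chi chiE] := pairing_surj (@altmap_comp K V E K^o K^o _ (fun x => (0, x)) idfun
   _ inr_linear (fun _ _ _ => erefl) Qa).
exists chi; apply: flat_inj => z; apply/eqP; rewrite -subr_eq0; apply/eqP.
have [[dm _] dw] := cyclic_linear (-1) (cyclic_Psi chi) Qc.
have FE y : flat ((-1) *: emb_V (Psi chi) + Q) y = flat Q y - flat (emb_V (Psi chi)) y.
  by rewrite [LHS]spair_linearl scaleN1r addrC.
rewrite -FE; move: z; apply: (homogeneous_form_eq0 dm dw) => z A.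
move=> cA; have -> : A = [set: 'I_n.+1]%SET.
  by apply/eqP; rewrite eqEcard finset.subsetT cardsT card_ord cA leqnn.
rewrite FE flat_Psi chiE; apply/eqP; rewrite subr_eq0; apply/eqP; congr (flat Q _).
by apply/ffunP => i; rewrite !ffunE inE.
Qed.

(** For a Lie bracket f, this is the bracket of the semidirect product of g with
    its coadjoint representation. *)
Definition cotangent_lift n (f : {ffun 'I_n.+1 -> g} -> g) : {ffun 'I_n.+1 -> E} -> E :=
  emb_g f + emb_gV (fstar f).

Lemma fstarE n (f : {ffun 'I_n.+1 -> g} -> g) x xi y : altmap f ->
  (fstar f x xi : 'Hom(g, K^o)) y = - (xi ord0 : 'Hom(g, K^o)) (f (frcons x y)).
Proof.
move=> fa; rewrite linfunE_linear // => a u v.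
by rewrite (altmap_last x fa) linearP opprD scalerN.
Qed.

Lemma cotangent_lift_fst n (f : {ffun 'I_n.+1 -> g} -> g) z :
  (cotangent_lift f z).1 = f [ffun i => (z i).1].
Proof.
by rewrite /cotangent_lift -[X in X.1]/(emb_g f z + emb_gV (fstar f) z) emb_gE /= addr0.
Qed.

(** The term of f itself is the one where the covector is the last argument; by
    the definition of f^star, the other terms have the same shape. *)
Lemma flat_cotangent_lift n (f : {ffun 'I_n.+1 -> g} -> g) z : altmap f ->
  flat (cotangent_lift f) z = shuffle_sum (addn1 n.+1)
    (fun u v => ((v ord0).2 : 'Hom(g, K^o)) (f [ffun i => (u i).1])) z.
Proof.
move=> fa; rewrite (shuffle_sum_last _ (addn0 n.+1) (addn1 n)).
have y : {ffun 'I_0 -> E} by apply: finfun; case.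
rewrite (shuffle_sum_n0 _ _ _ y).
have -> : frcons y (z ord_max) ord0 = z ord_max.
  by rewrite -[RHS](frcons_max y); congr (frcons _ _ _); apply/val_inj.
set z' := fdel ord_max z; rewrite /flat.
have -> : cotangent_lift f z' = (f [ffun i => (z' i).1], hat (addn1 n) (fstar f) z').
  rewrite /cotangent_lift -[LHS]/(emb_g f z' + emb_gV (fstar f) z') emb_gE.
  by congr pair; rewrite /= ?addr0 ?add0r.
rewrite /spair /= addrC; congr (_ + _).
rewrite hat_shuffle_sum /shuffle_sum sum_lfunE scaler_sumr; apply: eq_bigr => s _.
rewrite scale_lfunE fstarE // expr1 scaleN1r scalerN; congr (- (_ *: _)).
rewrite !ffunE; congr (_ (f _)).
apply/ffunP => i; rewrite [RHS]ffunE; case: (unliftP ord_max i) => [k|] ->.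
  by rewrite !frcons_lift !ffunE.
by rewrite !frcons_max.
Qed.

Lemma cyclic_cotangent_lift n (f : {ffun 'I_n.+1 -> g} -> g) :
  altmap f -> cyclic 0 (cotangent_lift f).
Proof.
move=> fa; have F z := flat_cotangent_lift z fa; split.
  rewrite (funext F); apply: shuffle_sum_altmap => u.
    have ul : linear ((u ord0).2 : 'Hom(g, K^o)) by move=> a x y; rewrite linearP.
    exact: (@altmap_comp K E g g K^o _ fst _ f (fun _ _ _ => erefl) ul fa).
  split=> [x i a v w|x i j].
    by rewrite !ffunE (ord1 i) eqxx add_lfunE scale_lfunE.
  by rewrite !ord1 eqxx.
move=> z; rewrite !F -shuffle_sumZ; apply: eq_bigr => s _; congr (_ *: _).
have D m (h : 'I_m -> 'I_(n.+1 + 1)) :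
    [ffun a => fcast (addn1 n.+1) (dilate_tuple z) (h a)] =
    dilate_tuple [ffun a => fcast (addn1 n.+1) z (h a)].
  by apply/ffunP => a; rewrite !ffunE.
rewrite !D; set u := [ffun a => _ _ (s (lshift _ _))]; set v := [ffun a => _ _ (s (rshift _ _))].
have -> : [ffun i => (dilate_tuple u i).1] = [ffun i => (u i).1].
  by apply/ffunP => i; rewrite !ffunE.
have -> : dilate_tuple v ord0 = dilate (v ord0) by rewrite ffunE.
by rewrite scale_lfunE expr1.
Qed.

(** The flat of a map of weight 0 takes exactly one covector, and alternation moves it
    to the last position; there the form is the pairing of the covector
    with the g-component of P on g^n, which defines f. *)
Lemma cyclic_cotangent_liftP n (P : {ffun 'I_n.+1 -> E} -> E) : cyclic 0 P ->
  exists2 f : {ffun 'I_n.+1 -> g} -> g, altmap f & P = cotangent_lift f.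
Proof.
move=> Pc; have [Pa _] := Pc.
pose f (x : {ffun 'I_n.+1 -> g}) := (P [ffun i => (x i, 0)]).1.
have fE x (xi : 'Hom(g, K^o)) : xi (f x) = spair (P [ffun i => (x i, 0)]) (0, xi).
  by rewrite /spair /= linear0 add0r.
have fa : altmap f.
  have H xi : altmap (fun x => (xi : 'Hom(g, K^o)) (f x)).
    under [X in altmap X]funext do rewrite fE.
    apply: (@altmap_comp K g E K^o K^o _ (fun x => (x, 0)) idfun (fun z => spair (P z) (0, xi))).
    - exact: inl_linear.
    - by [].
    - exact: altmap_spair.
  split=> [x i a u v|x i j ij xij]; apply: dual_sep => xi.
    by have [m _] := H xi; rewrite m linearP.
  by have [_ m] := H xi; rewrite (m _ _ _ ij xij) linear0.
exists f => //; apply: flat_inj => z; apply/eqP; rewrite -subr_eq0; apply/eqP.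
have [da dw] := cyclic_linear (-1) (cyclic_cotangent_lift fa) Pc; have [dm _] := da.
have FE y : flat ((-1) *: cotangent_lift f + P) y = flat P y - flat (cotangent_lift f) y.
  by rewrite [LHS]spair_linearl scaleN1r addrC.
rewrite -FE; move: z; apply: (homogeneous_form_eq0 dm dw) => z A /eqP/cards1P [a Aa].
set y := [ffun i => _]; pose s := tperm a ord_max.
suff : flat ((-1) *: cotangent_lift f + P) [ffun k => y (s k)] = 0.
  rewrite (altmap_perm _ _ da) => /eqP; rewrite scaler_eq0 signr_eq0 /=.
  by move/eqP.
have -> : [ffun k => y (s k)] =
   frcons [ffun j => ((y (s (lift ord_max j))).1, 0)] (0, (z a).2).
  apply/ffunP => i; rewrite [LHS]ffunE; case: (unliftP ord_max i) => [j|] ->.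
    rewrite frcons_lift [RHS]ffunE /y ffunE Aa inE.
    have /negbTE -> : s (lift ord_max j) != a; last by [].
    rewrite -[X in _ != X](tpermR a ord_max) (inj_eq perm_inj) eq_sym; exact: neq_lift.
  by rewrite frcons_max /y /s tpermR ffunE Aa inE eqxx.
rewrite FE !flat_frcons; set x := [ffun j => _].
have E0 b : spair b (0, (z a).2) = ((z a).2 : 'Hom(g, K^o)) b.1.
  by rewrite /spair /= linear0 add0r.
rewrite !E0 cotangent_lift_fst /f; set x1 := [ffun i => (_, 0)].
have -> : x1 = x by apply/ffunP => i; rewrite !ffunE.
by rewrite subrr.
Qed.

End CyclicWeights.

(** * The image of the embedding *)

Section Image.
Variables (K : fieldType) (g : vectType K).
Hypothesis hK : [pchar K] =i pred0.
Local Notation V := (dual g).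
Local Notation E := (g * V)%type.

Lemma emb_Psi0 n : emb_V (Psi (0 : ext g n.+1)) = 0.
Proof.
apply: flat_inj => z; rewrite flat_Psi /flat /spair /= zero_lfunE linear0 addr0.
by rewrite /pairing /extlift big1 // => t _; rewrite ffunE scale0r.
Qed.

Lemma tlb_image1 (c : amb g V 1) : tlb_image (n := 1) c <-> cyclic 0 c.1 /\ c.2 = 0.
Proof.
split=> [[[f chi] [/= fa ->] <-]|[/(cyclic_cotangent_liftP hK) [f fa c1] c2]].
  by split; [exact: cyclic_cotangent_lift | exact: emb_Psi0].
exists (f, 0); first by split.
by rewrite /= emb_Psi0 [RHS]surjective_pairing c1 c2.
Qed.

(** In this form the image is visibly a linear subspace, and its stability under
    the differential becomes a count of weights. *)
Lemma tlb_imageSS m (c : amb g V m.+2) :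
  tlb_image (n := m.+2) c <-> cyclic 0 c.1 /\ cyclic m.+1 c.2.
Proof.
split=> [[[f chi] /= fa <-]|[/(cyclic_cotangent_liftP hK) [f fa c1] /(cyclic_PsiP hK) [chi c2]]].
  by split; [exact: cyclic_cotangent_lift | exact: cyclic_Psi].
by exists (f, chi); rewrite // [RHS]surjective_pairing c1 c2.
Qed.

Lemma fstar_mixmap n (f : {ffun 'I_n.+1 -> g} -> g) : altmap f -> mixmap (fstar f).
Proof.
move=> fa; split=> [v|x]; split.
- move=> x i a u w; apply/lfunP => y; rewrite add_lfunE scale_lfunE !fstarE //.
  by have [m _] := altmap_frcons y fa; rewrite m linearP opprD scalerN.
- move=> x i j ij xij; apply/lfunP => y; rewrite fstarE // zero_lfunE.
  by have [_ m] := altmap_frcons y fa; rewrite (m _ _ _ ij xij) linear0 oppr0.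
- move=> v i a u w; apply/lfunP => y; rewrite add_lfunE scale_lfunE !fstarE //.
  by rewrite !ffunE (ord1 i) eqxx add_lfunE scale_lfunE opprD scalerN.
- by move=> v i j; rewrite !ord1 eqxx.
Qed.

Lemma Psi_altmap n (chi : ext g n.+1) : altmap (Psi chi).
Proof.
have H eta := altmap_frcons eta (pairing_altmap chi).
split=> [x i a u v|x i j ij xij]; apply: dual_sep => eta.
  by have [m _] := H eta; rewrite Psi_pairing m -!Psi_pairing linearP.
by rewrite Psi_pairing linear0; have [_ m] := H eta; rewrite (m _ _ _ ij xij).
Qed.

Lemma br_altmap (br : g -> g -> g) : lie_bracket br ->
  altmap (fun x : {ffun 'I_2 -> g} => br (x ord0) (x ord_max)).
Proof.
move=> L.
have c2 (i : 'I_2) : i = ord0 \/ i = ord_max.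
  by case: i => [[|[|//]] p]; [left|right]; apply/val_inj.
split=> [x i a u v|x i j].
  by rewrite !ffunE; have [->|->] := c2 i; rewrite /= (lie_linearl L, lie_linearr L).
by have [->|->] := c2 i; have [->|->] := c2 j; rewrite ?eqxx // => _ ->; rewrite (lie_alt L).
Qed.

(** For f the Lie bracket, f^star is the coadjoint representation. *)
Lemma cyclic_pi (br : g -> g -> g) : lie_bracket br -> cyclic 0 (pi_elt br (coad br)).
Proof.
move=> /br_altmap/cyclic_cotangent_lift; rewrite /cotangent_lift /pi_elt.
set h1 := fstar _; set h2 := (fun _ _ => coad _ _ _); suff -> : h1 = h2 by [].
apply/funext => x; apply/funext => xi; rewrite /h1 /h2 /fstar /coad; congr linfun.
apply/funext => y; rewrite frcons_max.
have -> : ord0 = lift ord_max ord0 :> 'I_2 by apply/val_inj.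
by rewrite frcons_lift.
Qed.

Lemma cyclic_T (r : ext g 2) : cyclic 1 (T_elt (rsharp r)).
Proof.
have := cyclic_Psi r; rewrite /T_elt; set t := (fun v : _ => rsharp _ _).
suff -> : Psi r = t by [].
apply/funext => v; rewrite /t /rsharp /Psi.
by have -> : [ffun=> v ord0] = v by apply/ffunP => i; rewrite ffunE (ord1 i).
Qed.

Lemma cyclicZ n k a (P : {ffun 'I_n -> E} -> E) : cyclic k P -> cyclic k (a *: P).
Proof. by move=> Pc; rewrite -[_ *: P]addr0; apply: cyclic_linear => //; apply: cyclic0. Qed.

Lemma cyclic_iter n k (P T : _) j : cyclic k P -> cyclic 1 T ->
  cyclic (k + j) (iter j (fun P => @nr K E n 0 n (addn0 n) P T) P).
Proof.
move=> Pc Tc; elim: j => [|j IH]; first by rewrite addn0.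
by rewrite addnS -(addn1 (k + j)); apply: (cyclic_nr hK (addn0 n) IH Tc).
Qed.

Lemma tlb_image_cochain n : (tlb_image (n := n) `<=` @rrb_cochain K g V n)%classic.
Proof.
case: n => [|[|n]] c [[f chi]] /=.
- by move=> _ <-.
- move=> [fa ->] <-; exists f, (fstar f); split=> //.
    exact: fstar_mixmap.
  by rewrite emb_Psi0.
move=> fa <-; exists f, (fstar f), (Psi chi); split=> //.
  exact: fstar_mixmap.
exact: Psi_altmap.
Qed.

Lemma tlb_image_linear n a (c d : amb g V n) :
  tlb_image c -> tlb_image d -> tlb_image (a *: c + d).
Proof.
case: n c d => [|[|n]] c d.
- move=> [? _ <-] [? _ <-]; exists 0 => //=. by rewrite scaler0 addr0.
- move=> /tlb_image1 [c1 c2] /tlb_image1 [d1 d2]; apply/tlb_image1; split.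
    exact: cyclic_linear.
  by rewrite -[LHS]/(a *: c.2 + d.2) c2 d2 scaler0 addr0.
move=> /tlb_imageSS [c1 c2] /tlb_imageSS [d1 d2]; apply/tlb_imageSS.
by split; apply: cyclic_linear.
Qed.

Lemma tlb_image0 n : tlb_image (0 : amb g V n).
Proof.
case: n => [|[|n]].
- by exists 0.
- by apply/tlb_image1; split=> //; apply: cyclic0.
- by apply/tlb_imageSS; split; apply: cyclic0.
Qed.

Lemma tlb_image_D (br : g -> g -> g) (r : ext g 2) n (c : amb g V n) : lie_bracket br ->
  tlb_image c -> tlb_image (rrb_D br (coad br) (rsharp r) c).
Proof.
move=> L; have pc := cyclic_pi L; have Tc := cyclic_T r.
case: n c => [|n] c; first by move=> _; exact: tlb_image0.
have hc1 : tlb_image c -> cyclic 0 c.1.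
  by case: n c => [|n] c; [case/tlb_image1 | case/tlb_imageSS].
move=> cI; have c1 := hc1 cI.
rewrite /rrb_D -[X in tlb_image X]addr0; apply: tlb_image_linear; last exact: tlb_image0.
apply/tlb_imageSS; split.
  rewrite -[X in cyclic _ X]/(- nr (add1n n) (pi_elt br (coad br)) c.1) -scaleN1r.
  by apply: cyclicZ; apply: (cyclic_nr hK (add1n n) pc c1).
have it := cyclicZ ((n.+1)`!%:R^-1) (cyclic_iter n.+1 c1 Tc).
case: n c cI {hc1} c1 it => [|n] c cI c1 it.
  by rewrite -[X in cyclic _ X]/(0 + _) add0r.
have [_ c2] := (tlb_imageSS c).1 cI.
have := cyclic_linear 1 (cyclic_nr hK (add1n n) (cyclic_nr hK (addn0 1) pc Tc) c2) it.
by rewrite scale1r.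
Qed.
End Image.

Theorem proposition4p19 (K : fieldType) (hK : [pchar K] =i pred0)
    (g : vectType K) (br : g -> g -> g) (r : ext g 2)
    (hr : triangular br r) :
  subcomplex (@rrb_cochain K g (dual g))
    (@rrb_D K g (dual g) br (coad br) (rsharp r))
    (@tlb_image K g).
Proof.
move=> n; split; first exact: tlb_image_cochain.
  split=> [|a c d]; rewrite !in_setE; first exact: tlb_image0.
  exact: tlb_image_linear.
by move=> c; apply: tlb_image_D => //; case: hr.
Qed.
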